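(* If a set $\Lambda\subset\mathbb{Z}^+$ contains arbitrarily long segments (that is, for every $n\in\mathbb{Z}^+$ it contains $n$ consecutive integers), then $\Lambda$ is a Menshov spectrum in measure.
   Context: $\mathbb{Z}^+=\{1,2,\ldots\}$; $\mathbb{T}=\mathbb{R}/2\pi\mathbb{Z}$ with normalized Lebesgue measure; $L^0(\mathbb{T})$ is the space of all measurable functions $f:\mathbb{T}\to\mathbb{C}$. A set $\Lambda\subset\mathbb{Z}$ is a Menshov spectrum in measure if for every $f\in L^0(\mathbb{T})$ there are complex coefficients $(c_k)_{k\in\Lambda}$ such that the partial sums $\sum_{k\in\Lambda,\,|k|\le N}c_k e^{ikt}$ converge to $f$ in measure on $\mathbb{T}$ as $N\to\infty$. *)

(* Defs.v *)
From mathcomp Require Import all_boot all_order all_algebra.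
From mathcomp Require Import all_classical all_reals all_analysis.
From mathcomp Require Import complex.
Set Implicit Arguments.
Unset Strict Implicit.
Unset Printing Implicit Defensive.
Import Order.TTheory GRing.Theory Num.Theory.
Import numFieldNormedType.Exports.

Local Open Scope classical_set_scope.
Local Open Scope complex_scope.
Local Open Scope ring_scope.

(* [R] with the sigma-algebra of Lebesgue-measurable (not only Borel) sets: the
   domain of [completed_lebesgue_measure]. *)
Definition lebesgueTypeR (R : realType) :=
  caratheodory_type ((@wlength R idfun)^*)%mu.

Lemma measurable_period (R : realType) :
  measurable (`[0, 2 * pi[%classic : set (lebesgueTypeR R)).
Proof.
apply: sub_caratheodory.
exact: (measurable_itv `[0, 2 * pi[ : measurable (_ : set (measurableTypeR R))).
Qed.

Lemma inv_period_ge0 (R : realType) : 0 <= (2 * pi : R)^-1.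
Proof. by rewrite invr_ge0 mulr_ge0 ?pi_ge0. Qed.

(* Functions on the circle R/2piZ are represented by 2pi-periodic functions on
   the real line; the normalized Lebesgue measure of the circle then reads
   A |-> |A `&` [0, 2pi)| / 2pi. *)
Definition circle_measure (R : realType) :
    {measure set (lebesgueTypeR R) -> \bar R} :=
  mscale (NngNum (inv_period_ge0 R))
    (mrestr (@completed_lebesgue_measure R) (@measurable_period R)).

Definition measurable_fun_complex d (T : measurableType d) (R : realType)
    (f : T -> R[i]) : Prop :=
  measurable_fun [set: T] (fun t => complex.Re (f t)) /\
  measurable_fun [set: T] (fun t => complex.Im (f t)).

Definition circle_L0 (R : realType) : set (R -> R[i]) :=
  [set f | periodic f (2 * pi) /\
           measurable_fun_complex (f : lebesgueTypeR R -> R[i])].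

Definition cvg_in_measure d (T : measurableType d) (R : realType)
    (mu : {measure set T -> \bar R}) (u : nat -> T -> R[i]) (f : T -> R[i])
    : Prop :=
  forall eps : R, 0 < eps ->
    mu [set t | eps%:C <= `|u n t - f t|] @[n --> \oo] --> 0%E.

(* exp (i k t), by Euler's formula. *)
Definition expik (R : realType) (k : int) (t : R) : R[i] :=
  cos (k%:~R * t) +i* sin (k%:~R * t).

Definition trig_partial_sum (R : realType) (L : set int) (c : int -> R[i])
    (N : nat) (t : R) : R[i] :=
  \sum_(k \in L `&` [set k : int | (`|k| <= N)%N]) c k * expik k t.

(* Only the values of [c] on [L] matter. *)
Definition menshov_spectrum_in_measure (R : realType) (L : set int) : Prop :=
  forall f : R -> R[i], circle_L0 f ->
    exists c : int -> R[i],
      cvg_in_measure (@circle_measure R) (trig_partial_sum L c) f.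

Definition has_long_segments (L : set int) : Prop :=
  forall n : nat, (0 < n)%N ->
    exists a : int, forall j : nat, (j < n)%N -> L (a + j%:Z).

(* Main.v *)
(** Run a random-walk-like multiplicative process on the residual.  Given a
bounded [f], put [rho_0 = f] and
[rho_(j+1) = rho_j (1 - a chi_j e^(i n_j t))], where [n_j] grows very fast and
[chi_j] is the indicator of the points that have not been stopped yet.  Up to
[O(a^3)] per step, [log |rho_j / f|] is bounded by
[X_j = - sum chi_i (a cos(n_i t) + a^2/2 cos(2 n_i t))], which by the
Riemann-Lebesgue lemma behaves like a martingale with variance about [a^2/2] per
step.  It is stopped on leaving [(-A, B)]; after [m^3] steps of size [a = 1/m]
almost every point has been stopped, and by optional stopping the exit at the top
has probability at most about [A / B].  Hence [|rho| <= C e^-A |f|] off a small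
set, while [|rho_j| <= C e^B |f|] always.

The increment [a chi_j rho_j e^(i n_j t)] is approximated in [L^2] by a
trigonometric polynomial shifted into a long segment of [L].  Since its [L^2]
norm is [O(a)], Parseval and Chebyshev make all its partial sums small in measure:
no maximal inequality is needed.  In stage [n] the process is applied separately
to the part of the residual below [e^-n], with [B] about [n / 2], and to the
remaining part, supported on a small set, with a huge [A]; the partial sums of the
stage are then of order [e^(-n/2)] off a set of measure [O(1/n)]. *)

Require Import Defs.
From mathcomp Require Import all_boot all_order all_algebra.
From mathcomp Require Import all_classical all_reals all_analysis.
From mathcomp Require Import measurable_realfun complex.
From mathcomp Require Import ring lra zify.
Set Implicit Arguments.
Unset Strict Implicit.
Unset Printing Implicit Defensive.
Import Order.TTheory GRing.Theory Num.Theory.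
Import numFieldNormedType.Exports.
Local Open Scope classical_set_scope.
Local Open Scope complex_scope.
Local Open Scope ring_scope.

(** * Mean values on the circle *)

Section CircleMean.
Variable R : realType.
Notation T := (lebesgueTypeR R).
Notation mu := (circle_measure R).

Lemma circle_measureE (A : set T) :
  mu A = (((2 * pi)^-1)%R%:E * completed_lebesgue_measure (A `&` `[0%R, (2 * pi)%R[%classic))%E.
Proof. by []. Qed.

Lemma completed_lebesgue_measureE (A : set (measurableTypeR R)) :
  completed_lebesgue_measure A = lebesgue_measure A.
Proof. by []. Qed.

Lemma pi2_gt0 : 0 < 2 * pi :> R.
Proof. by rewrite mulr_gt0 ?pi_gt0. Qed.

Lemma circle_measureT : mu setT = 1%E.
Proof.
rewrite circle_measureE setTI completed_lebesgue_measureE.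
rewrite lebesgue_measure_itv /= lte_fin pi2_gt0 -EFinB -EFinM subr0.
by rewrite mulVf // gt_eqF // pi2_gt0.
Qed.

(** The bound is asked at every point, not almost everywhere, so that all later comparisons can be
    made pointwise. *)
Variant bounded_measurable (f : R -> R) : Prop :=
  BoundedMeasurable of measurable_fun [set: T] (f : T -> R) &
    exists M : R, forall t, `|f t| <= M.

Notation bm := bounded_measurable.

Definition mean (f : R -> R) : R := \int[mu]_(x in [set: T]) f x.

Lemma bm_integrable f : bm f -> mu.-integrable [set: T] (EFin \o f).
Proof.
move=> [mf [M hM]]; apply: measurable_bounded_integrable => //=.
- by change (mu setT < +oo)%E; rewrite circle_measureT ltry.
- exists M; split; first exact: num_real.
  by move=> x Mx y _; apply: le_trans (hM y) _; exact: ltW.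
Qed.

Lemma bm_measurable f : bm f -> measurable_fun [set: T] (f : T -> R).
Proof. by case. Qed.

Lemma bm_cst c : bm (fun=> c).
Proof. by split; [exact: measurable_cst|exists `|c|]. Qed.

Lemma bmD f g : bm f -> bm g -> bm (fun t => f t + g t).
Proof.
move=> [mf [M hM]] [mg [N hN]]; split; first exact: measurable_funD.
by exists (M + N) => t; rewrite (le_trans (ler_normD _ _))// lerD.
Qed.

Lemma bmM f g : bm f -> bm g -> bm (fun t => f t * g t).
Proof.
move=> [mf [M hM]] [mg [N hN]]; split; first exact: measurable_funM.
by exists (M * N) => t; rewrite normrM ler_pM.
Qed.

Lemma bmN f : bm f -> bm (fun t => - f t).
Proof.
move=> [mf [M hM]]; split; first exact: measurableT_comp.
by exists M => t; rewrite normrN.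
Qed.

Lemma bmB f g : bm f -> bm g -> bm (fun t => f t - g t).
Proof. by move=> bf bg; exact: (bmD bf (bmN bg)). Qed.

(** [f] takes its values in a compact interval [[- M, M]], on which the continuous [h] attains a
    maximum and a minimum. *)
Lemma bm_comp (h f : R -> R) : continuous h -> bm f -> bm (h \o f).
Proof.
move=> ch [mf [M hM]]; split.
  apply: (measurableT_comp (f := h)) => //.
  exact: continuous_measurable_fun.
have M0 : 0 <= M by apply: le_trans (hM 0).
have ch' : {within `[- M, M], continuous h} by exact: continuous_subspaceT.
have MM : - M <= M by lra.
have [c _ hc] := EVT_max MM ch'; have [d _ hd] := EVT_min MM ch'.
exists (Num.max `|h c| `|h d|) => t.
have ft : f t \in `[- M, M] by rewrite in_itv /= -ler_norml.
move: (hc _ ft) (hd _ ft) => /= h1 h2.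
rewrite le_max; apply/orP; have [h0|h0] := leP 0 (h (f t)); [left|right].
  by rewrite /= ger0_norm// (le_trans h1)// ler_norm.
by rewrite /= ltr0_norm// -[leRHS]normrN (le_trans _ (ler_norm _))// lerN2.
Qed.

Lemma bm_indic (A : set T) : measurable A -> bm (\1_A : R -> R).
Proof.
move=> mA; split; first exact: measurable_indic.
by exists 1 => t; rewrite indicE; case: (_ \in _); rewrite ?normr1 ?normr0.
Qed.

Lemma measurable_ltr (f g : T -> R) : measurable_fun setT f ->
  measurable_fun setT g -> measurable [set t | f t < g t].
Proof.
move=> mf mg; rewrite -[X in measurable X]setTI.
have := measurable_fun_ltr mf mg measurableT.
by move=> /(_ [set true]); apply.
Qed.

Lemma measurable_ler (f g : T -> R) : measurable_fun setT f ->
  measurable_fun setT g -> measurable [set t | f t <= g t].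
Proof.
move=> mf mg; rewrite -[X in measurable X]setTI.
have := measurable_fun_ler mf mg measurableT.
by move=> /(_ [set true]); apply.
Qed.

Lemma measurable_continuousT (f : R -> R) : continuous f ->
  measurable_fun [set: T] (f : T -> R).
Proof.
move=> cf; have := continuous_measurable_fun cf => mf _ B mB; rewrite setTI.
by apply: sub_caratheodory; rewrite -[X in measurable X]setTI; exact: mf.
Qed.

Lemma meanD f g : bm f -> bm g -> mean (fun t => f t + g t) = mean f + mean g.
Proof. by move=> bf bg; rewrite /mean RintegralD//; exact: bm_integrable. Qed.

Lemma meanB f g : bm f -> bm g -> mean (fun t => f t - g t) = mean f - mean g.
Proof. by move=> bf bg; rewrite /mean RintegralB//; exact: bm_integrable. Qed.

Lemma meanZ c f : bm f -> mean (fun t => c * f t) = c * mean f.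
Proof. by move=> bf; rewrite /mean RintegralZl//; exact: bm_integrable. Qed.

Lemma mean_cst c : mean (fun=> c) = c.
Proof.
rewrite /mean Rintegral_cst//.
by rewrite circle_measureT /= mulr1.
Qed.

Lemma le_mean f g : bm f -> bm g -> (forall t, f t <= g t) -> mean f <= mean g.
Proof.
by move=> bf bg fg; apply: le_Rintegral => //; exact: bm_integrable.
Qed.

Lemma mean_ge0 f : (forall t, 0 <= f t) -> 0 <= mean f.
Proof. by move=> f0; exact: Rintegral_ge0. Qed.

Lemma eq_mean f g : f =1 g -> mean f = mean g.
Proof. by move=> /funext ->. Qed.

Lemma norm_mean f : bm f -> `|mean f| <= mean (fun t => `|f t|).
Proof. by move=> bf; apply: le_normr_Rintegral => //; exact: bm_integrable. Qed.

Lemma bm_norm f : bm f -> bm (fun t => `|f t|).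
Proof.
move=> [mf [M hM]]; split; first exact: measurableT_comp.
by exists M => t; rewrite normr_id.
Qed.

(** Dominated convergence: the constant [M] is integrable because the circle has total mass 1. *)
Lemma mean_cvg (f_ : nat -> R -> R) (f : R -> R) (M : R) :
  (forall n, bm (f_ n)) -> bm f -> (forall n t, `|f_ n t| <= M) ->
  (forall t, f_ ^~ t @ \oo --> f t) ->
  (fun n => mean (f_ n)) @ \oo --> mean f.
Proof.
move=> bf_ bf hM cf.
have [_ _ h] := @dominated_convergence _ T _ mu setT measurableT
  (fun n t => (f_ n t)%:E) (EFin \o f) (fun=> M%:E)
  (fun n => (iffRL (measurable_EFinP _ _) (bm_measurable (bf_ n))))
  (iffRL (measurable_EFinP _ _) (bm_measurable bf))
  ltac:(by apply: nearW => t _; apply: cvg_EFin; [exact: nearW|exact: cf])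
  (bm_integrable (bm_cst M))
  ltac:(by apply: nearW => t n _; rewrite lee_fin; exact: hM).
apply: fine_cvg; rewrite fineK //.
exact: (integrable_fin_num _ (bm_integrable bf)).
Qed.

Definition prob (A : set R) : R := mean (\1_A : R -> R).

Lemma probE (A : set T) : measurable A -> mu A = (prob A)%:E.
Proof.
move=> mA; rewrite /prob /mean /Rintegral fineK; last first.
  exact: (integrable_fin_num _ (bm_integrable (bm_indic mA))).
by rewrite integral_indic// setIT.
Qed.

End CircleMean.

(** * Mean values of sines and cosines *)

Section Orthogonality.
Variable R : realType.
Notation T := (lebesgueTypeR R).
Notation mu := (circle_measure R).
Notation bm := (@bounded_measurable R).

(** A nonnegative integral passes through the scaling, the restriction to [0, 2 pi) and the change
    of sigma-algebra, after which the fundamental theorem of calculus applies. Signed integrands are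
    first shifted by a constant. *)
Lemma mean_derive (f F : R -> R) : continuous f -> (forall t, 0 <= f t) ->
  (forall t : R, is_derive t (1 : R) F (f t)) ->
  mean f = (2 * pi)^-1 * (F (2 * pi) - F 0).
Proof.
move=> cf f0 dF; rewrite /mean /Rintegral.
have mf : measurable_fun [set: T] (EFin \o (f : T -> R)).
  by apply/measurable_EFinP; exact: measurable_continuousT.
pose D : set T := `[0, 2 * pi[%classic.
have mD : measurable D := @measurable_period R.
rewrite ge0_integral_mscale//; last by move=> x _; rewrite /= lee_fin.
suff -> : (\int[mrestr completed_lebesgue_measure mD]_x (f x)%:E =
           (F (2 * pi) - F 0)%:E)%E by [].
rewrite -(setUv D) ge0_integral_setU//=; last first.
- by apply/disj_setPS => x [].
- by move=> x _; rewrite lee_fin.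
- by rewrite setUv.
- exact: measurableC.
rewrite [X in (_ + X)%E](_ : _ = 0%E) ?adde0; last first.
  apply: null_set_integral => //=.
  - exact: measurableC.
  - exact: measurable_funTS.
  - by rewrite /mrestr setICl measure0.
rewrite (@eq_measure_integral _ _ _ _ completed_lebesgue_measure)//; last first.
  move=> A mA AD.
  change (completed_lebesgue_measure (A `&` D) = completed_lebesgue_measure A).
  by rewrite (setIidl AD).
(* The identity from the Lebesgue to the Borel sigma-algebra is measurable, and it pushes the
   completed measure forward to Lebesgue measure on Borel sets. *)
have mid : measurable_fun [set: T] (id : T -> measurableTypeR R).
  by move=> _ B mB; rewrite setTI; exact: sub_caratheodory.
have mDB : measurable (D : set (measurableTypeR R)).
  exact: (measurable_itv `[0, 2 * pi[).
have mfB : measurable_fun [set: measurableTypeR R] (EFin \o f).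
  by apply/measurable_EFinP; exact: continuous_measurable_fun.
transitivity (\int[@lebesgue_measure R]_(x in D) (f x)%:E)%E.
  apply/esym.
  have := @ge0_integral_pushforward _ _ _ _ R _ mid (@completed_lebesgue_measure R) D (EFin \o f) mDB (measurable_funTS mfB).
  by apply => x _ /=; rewrite lee_fin.
rewrite integral_itv_bndo_bndc; last first.
  by apply/measurable_EFinP; apply: measurable_funTS; exact: continuous_measurable_fun.
have cF : continuous F.
  by move=> t; apply/differentiable_continuous/derivable1_diffP; exact: ex_derive.
rewrite (@continuous_FTC2 _ f F).
- by rewrite EFinB.
- exact: pi2_gt0.
- exact: continuous_subspaceT.
- split.
  + by move=> x _; exact: ex_derive.
  + by apply: cvg_at_right_filter; exact: cF.
  + by apply: cvg_at_left_filter; exact: cF.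
- by move=> x _; rewrite derive1E derive_val.
Qed.

Lemma continuous_cosM (a : R) : continuous (fun t : R => cos (a * t)).
Proof.
move=> t; apply: (@continuous_comp _ _ _ ( *%R a) cos); last exact: continuous_cos.
exact: mulrl_continuous.
Qed.

Lemma continuous_sinM (a : R) : continuous (fun t : R => sin (a * t)).
Proof.
move=> t; apply: (@continuous_comp _ _ _ ( *%R a) sin); last exact: continuous_sin.
exact: mulrl_continuous.
Qed.

Lemma bm_cosM (a : R) : bm (fun t => cos (a * t)).
Proof.
split; first by apply: measurable_continuousT; exact: continuous_cosM.
by exists 1 => t; rewrite ler_norml cos_geN1 cos_le1.
Qed.

Lemma bm_sinM (a : R) : bm (fun t => sin (a * t)).
Proof.
split; first by apply: measurable_continuousT; exact: continuous_sinM.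
by exists 1 => t; rewrite ler_norml sin_geN1 sin_le1.
Qed.

Lemma cos_intpi (k : int) : cos (k%:~R * (2 * pi)) = 1 :> R.
Proof.
have h (n : nat) : cos (n%:R * (2 * pi)) = 1 :> R.
  have -> : n%:R * (2 * pi) = 0 + (pi *+ 2) *+ n :> R.
    by rewrite add0r -[pi *+ 2]mulr_natl -[RHS]mulr_natl.
  by rewrite (periodicn (@cosD2pi R)) cos0.
case: k => n; first exact: h.
by rewrite NegzE mulrNz mulNr cosN h.
Qed.

Lemma sin_intpi (k : int) : sin (k%:~R * (2 * pi)) = 0 :> R.
Proof.
apply/eqP; rewrite -sqrf_eq0 -(inj_eq (addrI 1)) addr0.
by have := cos2Dsin2 (k%:~R * (2 * pi) : R); rewrite cos_intpi expr1n => ->.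
Qed.

Lemma is_derive_sinM (a t : R) :
  is_derive t (1 : R) (fun s : R => sin (a * s)) (a * cos (a * t)).
Proof.
rewrite mulrC; apply: (@is_derive1_comp _ sin ( *%R a) t (cos (a * t)) a).
apply: is_derive_eq; exact: mulr1.
Qed.

Lemma is_derive_cosM (a t : R) :
  is_derive t (1 : R) (fun s : R => cos (a * s)) (a * - sin (a * t)).
Proof.
rewrite mulrC; apply: (@is_derive1_comp _ cos ( *%R a) t (- sin (a * t)) a).
apply: is_derive_eq; exact: mulr1.
Qed.

Lemma mean_cos (k : int) : k != 0 -> mean (fun t : R => cos (k%:~R * t)) = 0.
Proof.
move=> k0; have k0' : k%:~R != 0 :> R by rewrite intr_eq0.
have bc := bm_cosM k%:~R.
(* Adding 1 makes the integrand nonnegative; the extra term [t] of the primitive contributes exactly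
   1 to the mean. *)
have := @mean_derive (fun t => cos (k%:~R * t) + 1)
  (fun t => k%:~R^-1 * sin (k%:~R * t) + t).
rewrite meanD// ?mean_cst; last exact: bm_cst.
move=> h; apply: (addIr 1); apply: (etrans (h _ _ _)).
- by move=> t; apply: cvgD; [exact: continuous_cosM|exact: cvg_cst].
- by move=> t; have := cos_geN1 (k%:~R * t); lra.
- move=> t; apply: is_deriveD.
  rewrite -[X in is_derive _ _ _ X](mulKf k0').
  exact: (is_deriveZ _ (is_derive_sinM _ _)).
- rewrite sin_intpi !mulr0 sin0 mulr0 add0r add0r subr0 add0r mulVf//.
  by rewrite gt_eqF// pi2_gt0.
Qed.

Lemma mean_sin (k : int) : mean (fun t : R => sin (k%:~R * t)) = 0.
Proof.
have [->|k0] := eqVneq k 0.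
  by rewrite -[RHS](mean_cst 0); apply: eq_mean => t; rewrite mul0r sin0.
have k0' : k%:~R != 0 :> R by rewrite intr_eq0.
have bc := bm_sinM k%:~R.
have := @mean_derive (fun t => sin (k%:~R * t) + 1)
  (fun t => - k%:~R^-1 * cos (k%:~R * t) + t).
rewrite meanD// ?mean_cst; last exact: bm_cst.
move=> h; apply: (addIr 1); apply: (etrans (h _ _ _)).
- by move=> t; apply: cvgD; [exact: continuous_sinM|exact: cvg_cst].
- by move=> t; have := sin_geN1 (k%:~R * t); lra.
- move=> t; apply: is_deriveD.
  apply: (is_derive_eq (is_deriveZ _ (is_derive_cosM k%:~R t))).
  by rewrite /GRing.scale /= mulNr !mulrN opprK mulKf.
- rewrite cos_intpi !mulr0 cos0 addr0 addrC addrA addNr add0r add0r mulVf//.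
  by rewrite gt_eqF// pi2_gt0.
Qed.

End Orthogonality.

(** * The modulus as a real number *)

Section ComplexModulus.
Variable R : realType.
Implicit Types z w : R[i].

(** The value of [|z|] lies in [R[i]]; this copy lies in [R], where it can be integrated and
    compared freely. *)
Definition cabs z : R := Num.sqrt (complex.Re z ^+ 2 + complex.Im z ^+ 2).

Lemma cabsE z : `|z| = (cabs z)%:C.
Proof. exact: normc_def. Qed.

Lemma cabs_ge0 z : 0 <= cabs z.
Proof. exact: sqrtr_ge0. Qed.

Lemma sqr_cabs z : cabs z ^+ 2 = complex.Re z ^+ 2 + complex.Im z ^+ 2.
Proof. by rewrite sqr_sqrtr// addr_ge0// sqr_ge0. Qed.

Lemma cabsM z w : cabs (z * w) = cabs z * cabs w.
Proof. by have := normrM z w; rewrite !cabsE -rmorphM => -[]. Qed.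

Lemma cabsD z w : cabs (z + w) <= cabs z + cabs w.
Proof. by have := ler_normD z w; rewrite !cabsE -rmorphD lecR. Qed.

Lemma cabsN z : cabs (- z) = cabs z.
Proof. by have := normrN z; rewrite !cabsE => -[]. Qed.

Lemma cabs0 : cabs 0 = 0.
Proof. by have := normr0 R[i]; rewrite cabsE => -[]. Qed.

Lemma cabsR (x : R) : cabs x%:C = `|x|.
Proof. by rewrite /cabs /= expr0n addr0 sqrtr_sqr. Qed.

Lemma cabs_Re z : `|complex.Re z| <= cabs z.
Proof.
rewrite -(ler_pXn2r (n := 2))// ?nnegrE ?cabs_ge0//.
by rewrite sqr_cabs real_normK ?num_real// lerDl sqr_ge0.
Qed.

Lemma cabs_Im z : `|complex.Im z| <= cabs z.
Proof.
rewrite -(ler_pXn2r (n := 2))// ?nnegrE ?cabs_ge0//.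
by rewrite sqr_cabs real_normK ?num_real// lerDr sqr_ge0.
Qed.

Lemma sqr_cabsD z w : cabs (z + w) ^+ 2 <= 2 * cabs z ^+ 2 + 2 * cabs w ^+ 2.
Proof.
have := cabsD z w; have := cabs_ge0 (z + w); have := sqr_ge0 (cabs z - cabs w).
by nra.
Qed.

End ComplexModulus.

(** * Complex exponentials and Parseval's identity *)

Section Exponentials.
Variable R : realType.
Notation e := (@expik R).

Lemma expikD j k t : e (j + k) t = e j t * e k t.
Proof.
rewrite /expik intrD mulrDl cosD sinD; simpc.
by rewrite addrC [sin _ * cos _ + _]addrC.
Qed.

Lemma expik0 t : e 0 t = 1.
Proof. by rewrite /expik mul0r cos0 sin0. Qed.

Lemma cabs_expik k t : cabs (e k t) = 1.
Proof. by rewrite /cabs /= cos2Dsin2 sqrtr1. Qed.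

Lemma expik_nat (k : nat) t : e k%:Z t = e 1 t ^+ k.
Proof.
elim: k => [|k IH]; first by rewrite expik0 expr0.
by rewrite exprS -IH -expikD; congr expik; lia.
Qed.

Lemma expikN k t : e (- k) t = (e k t)^*.
Proof. by rewrite /expik /= mulrNz mulNr cosN sinN. Qed.

Variant complex_bm (f : R -> R[i]) : Prop :=
  ComplexBM of bounded_measurable (fun t => complex.Re (f t)) &
    bounded_measurable (fun t => complex.Im (f t)).

Notation bm := (@bounded_measurable R).
Notation cbm := complex_bm.

Lemma cbm_cst c : cbm (fun=> c).
Proof. by split; exact: bm_cst. Qed.

Lemma cbmD f g : cbm f -> cbm g -> cbm (fun t => f t + g t).
Proof.
move=> [fr fi] [gr gi]; split.
  rewrite (_ : (fun _ => _) = fun t => complex.Re (f t) + complex.Re (g t)).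
    exact: bmD.
  by apply/funext => t; rewrite raddfD.
rewrite (_ : (fun _ => _) = fun t => complex.Im (f t) + complex.Im (g t)).
  exact: bmD.
by apply/funext => t; rewrite raddfD.
Qed.

Lemma complex_ReM (z w : R[i]) : complex.Re (z * w) =
  complex.Re z * complex.Re w - complex.Im z * complex.Im w.
Proof. by case: z w => [a b] [c d]. Qed.

Lemma complex_ImM (z w : R[i]) : complex.Im (z * w) =
  complex.Re z * complex.Im w + complex.Im z * complex.Re w.
Proof. by case: z w => [a b] [c d]. Qed.

Lemma cbmM f g : cbm f -> cbm g -> cbm (fun t => f t * g t).
Proof.
move=> [fr fi] [gr gi]; split.
  rewrite (_ : (fun _ => _) = fun t => complex.Re (f t) * complex.Re (g t) -
    complex.Im (f t) * complex.Im (g t)).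
    by apply: bmB; exact: bmM.
  by apply/funext => t; rewrite complex_ReM.
rewrite (_ : (fun _ => _) = fun t => complex.Re (f t) * complex.Im (g t) +
    complex.Im (f t) * complex.Re (g t)).
  by apply: bmD; exact: bmM.
by apply/funext => t; rewrite complex_ImM.
Qed.

Lemma cbmN f : cbm f -> cbm (fun t => - f t).
Proof.
move=> bf; rewrite (_ : (fun _ => _) = fun t => (-1) * f t).
  exact: (cbmM (cbm_cst (-1)) bf).
by apply/funext => t; rewrite mulN1r.
Qed.

Lemma cbmB f g : cbm f -> cbm g -> cbm (fun t => f t - g t).
Proof. by move=> bf bg; exact: (cbmD bf (cbmN bg)). Qed.

Lemma cbm_sum (I : Type) (r : seq I) (P : pred I) (F : I -> R -> R[i]) :
  (forall i, cbm (F i)) -> cbm (fun t => \sum_(i <- r | P i) F i t).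
Proof.
move=> bF; elim: r => [|i r IH].
  by under eq_fun do rewrite big_nil; exact: cbm_cst.
under eq_fun do rewrite big_cons.
by case: (P i); [exact: (cbmD (bF i) IH)|exact: IH].
Qed.

Lemma cbm_real f : bm f -> cbm (fun t => (f t)%:C).
Proof. by move=> bf; split => //; exact: bm_cst. Qed.

Lemma cbm_expik k : cbm (e k).
Proof. by split; [exact: bm_cosM|exact: bm_sinM]. Qed.

Lemma bm_sqr_cabs f : cbm f -> bm (fun t => cabs (f t) ^+ 2).
Proof.
move=> [fr fi]; under eq_fun do rewrite sqr_cabs !expr2.
by apply: bmD; exact: bmM.
Qed.

Lemma bm_cabs f : cbm f -> bm (fun t => cabs (f t)).
Proof.
move=> bf; rewrite (_ : (fun _ => _) = Num.sqrt \o (fun t => cabs (f t) ^+ 2)).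
  by apply: bm_comp; [exact: sqrt_continuous|exact: bm_sqr_cabs].
by apply/funext => t /=; rewrite sqrtr_sqr ger0_norm ?cabs_ge0.
Qed.

(** The real part is enough: as [z] is arbitrary, the imaginary part is the case of [z] times
    [- 'i]. *)
Lemma mean_expik (z : R[i]) (k : int) : k != 0 ->
  mean (fun t => complex.Re (z * e k t)) = 0.
Proof.
move=> k0; rewrite (_ : (fun _ => _) = fun t => complex.Re z * cos (k%:~R * t) -
    complex.Im z * sin (k%:~R * t)); last by apply/funext => t; rewrite complex_ReM.
have bc := bm_cosM (k%:~R : R); have bs := bm_sinM (k%:~R : R).
rewrite (meanB (bmM (bm_cst _) bc) (bmM (bm_cst _) bs)).
by rewrite (meanZ _ bc) (meanZ _ bs) mean_cos// mean_sin !mulr0 subr0.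
Qed.

Lemma bm_sum (I : Type) (r : seq I) (F : I -> R -> R) :
  (forall i, bm (F i)) -> bm (fun t => \sum_(i <- r) F i t).
Proof.
move=> bF; elim: r => [|i r IH].
  by under eq_fun do rewrite big_nil; exact: bm_cst.
by under eq_fun do rewrite big_cons; exact: bmD.
Qed.

Lemma mean_sum (I : Type) (r : seq I) (F : I -> R -> R) :
  (forall i, bm (F i)) ->
  mean (fun t => \sum_(i <- r) F i t) = \sum_(i <- r) mean (F i).
Proof.
move=> bF; elim: r => [|i r IH].
  by under eq_fun do rewrite big_nil; rewrite big_nil mean_cst.
under eq_fun do rewrite big_cons.
by rewrite (meanD (bF i) (bm_sum r bF)) big_cons IH.
Qed.

Lemma cbm_trig W (g : nat -> R[i]) : cbm (fun t => \sum_(k < W) g k * e k%:Z t).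
Proof. by apply: cbm_sum => k; apply: cbmM; [exact: cbm_cst|exact: cbm_expik]. Qed.

(** Induction on [W]: when the last term is split off, the cross term [h] of the square is a sum of
    exponentials of frequencies [k - W], all nonzero, so its mean vanishes. *)
Lemma parseval W (g : nat -> R[i]) :
  mean (fun t => cabs (\sum_(k < W) g k * e k%:Z t) ^+ 2) =
  \sum_(k < W) cabs (g k) ^+ 2.
Proof.
elim: W => [|W IH].
  rewrite big_ord0 -[RHS](mean_cst 0); apply: eq_mean => t.
  by rewrite big_ord0 cabs0 expr0n.
rewrite big_ord_recr/= -IH.
pose h t := \sum_(k < W) complex.Re (2 * g k * (g W)^* * e (k%:Z - W%:Z) t).
transitivity (mean (fun t => cabs (\sum_(k < W) g k * e k%:Z t) ^+ 2 +
   cabs (g W) ^+ 2 + h t)).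
  apply: eq_mean => t; rewrite big_ord_recr/=.
  set S := \sum_(k < W) _.
  have -> : h t = 2 * complex.Re (S * (g W * e W%:Z t)^*).
    rewrite /S big_distrl/= raddf_sum/= mulr_sumr; apply: eq_bigr => k _.
    rewrite expikD expikN rmorphM/=.
    have -> : 2 * g k * (g W)^* * (e k t * (e W t)^*) =
      2%:C * (g k * e k t * ((g W)^* * (e W t)^*)).
      by rewrite (_ : 2%:C = 2); [ring|rewrite rmorph_nat].
    by rewrite complex_ReM /= mul0r subr0.
  have -> : cabs (g W) ^+ 2 = cabs (g W * e W%:Z t) ^+ 2.
    by rewrite cabsM cabs_expik mulr1.
  move: S (g W * _) => z w; rewrite !sqr_cabs !raddfD/= complex_ReM.
  by case: w => a b /=; ring.
have bg := cbm_trig W g; have bh : forall k : 'I_W, bm (fun t =>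
    complex.Re (2 * g k * (g W)^* * e (k%:Z - W%:Z) t)).
  by move=> k; case: (cbmM (cbm_cst (2 * g k * (g W)^*)) (cbm_expik (k%:Z - W%:Z))).
rewrite meanD; first last.
- exact: bm_sum.
- by apply: bmD; [exact: bm_sqr_cabs|exact: bm_cst].
rewrite meanD ?mean_cst; [|exact: bm_sqr_cabs|exact: bm_cst].
rewrite /h mean_sum// big1 ?addr0// => k _; apply: mean_expik.
by have := ltn_ord k; lia.
Qed.

End Exponentials.
(** * Trigonometric polynomials *)

Section Bernoulli.
Variable R : realType.

Lemma bernoulli (x : R) n : -1 <= x -> 1 + n%:R * x <= (1 + x) ^+ n.
Proof.
move=> x1; elim: n => [|n IH]; first by rewrite mul0r addr0 expr0.
rewrite exprS -natr1.
have x10 : 0 <= 1 + x by lra.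
have := ler_wpM2l x10 IH; apply: le_trans.
have := mulr_ge0 (ler0n R n) (sqr_ge0 x); nra.
Qed.

(** Bernoulli bounds [(1 + y) ^+ n] from below, while the product of [(1 - y) ^+ n] and
    [(1 + y) ^+ n] is [(1 - y ^+ 2) ^+ n], at most 1. *)
Lemma bernoulli_inv (y : R) n : 0 <= y <= 1 -> (1 - y) ^+ n <= (1 + n%:R * y)^-1.
Proof.
move=> /andP[y0 y1].
have ny : 0 <= n%:R * y by rewrite mulr_ge0.
rewrite -[leRHS]mul1r ler_pdivlMr; last by lra.
have h : 0 <= 1 - y by lra.
have yN1 : -1 <= y by lra.
apply: le_trans (_ : (1 - y) ^+ n * (1 + y) ^+ n <= _).
  by rewrite ler_wpM2l ?exprn_ge0//; exact: bernoulli.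
rewrite -exprMn -subr_sqr expr1n exprn_ile1//.
  by rewrite subr_ge0 exprn_ile1.
by rewrite gerBl sqr_ge0.
Qed.

(** With [s] the square root of [r], one factor [s ^+ n] absorbs [n] by Bernoulli applied to [s^-1],
    and the other still tends to 0. *)
Lemma cvg_natM_expr (r : R) : 0 < r < 1 -> (fun n => n%:R * r ^+ n) @ \oo --> 0.
Proof.
move=> /andP[r0 r1]; pose s := Num.sqrt r.
have s0 : 0 < s by rewrite sqrtr_gt0.
have ss : s ^+ 2 = r by rewrite sqr_sqrtr// ltW.
have s1 : s < 1 by rewrite -(ltr_pXn2r (n := 2))// ?nnegrE ?ltW// ss expr1n.
have d0 : 0 < s^-1 - 1 by rewrite subr_gt0 invf_gt1.
apply: (@squeeze_cvgr _ _ _ _ (cst 0) (fun n => (s^-1 - 1)^-1 * s ^+ n)).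
- apply: nearW => n /=; rewrite mulr_ge0 ?exprn_ge0 ?(ltW r0)//=.
  rewrite -ss -exprM mulnC exprM expr2 mulrA ler_wpM2r ?exprn_ge0 ?(ltW s0)//.
  rewrite -[leRHS]mul1r ler_pdivlMr// mulrAC.
  have := @bernoulli (s^-1 - 1) n _; rewrite [1 + (_ - 1)]addrC subrK.
  move=> /(_ _) h; have {}h : 1 + n%:R * (s^-1 - 1) <= s^-1 ^+ n by apply: h; lra.
  have : n%:R * (s^-1 - 1) <= s^-1 ^+ n by lra.
  move=> /(ler_wpM2r (exprn_ge0 n (ltW s0))).
  by rewrite -exprMn mulVf ?gt_eqF// expr1n.
- exact: cvg_cst.
- apply: (@cvg_geometric R (s^-1 - 1)^-1 s).
  by rewrite gtr0_norm.
Qed.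

(** The exponent times [u ^+ n] equals [n (2 u)^n], which tends to 0 below one half and to infinity
    from one half on; the two Bernoulli bounds turn this into the limits 1 and 0. The factor [n] in
    the exponent is what settles the point [u = 1/2]. *)
Lemma cvg_step_approx (u : R) : 0 < u <= 1 ->
  (fun n => (1 - u ^+ n) ^+ (n * 2 ^ n)) @ \oo --> ((u < 2^-1)%R%:R : R).
Proof.
move=> /andP[u0 u1].
have un n : 0 <= u ^+ n <= 1 by rewrite exprn_ge0 ?(ltW u0)//= exprn_ile1// ltW.
have uE n : (n * 2 ^ n)%:R * u ^+ n = n%:R * (2 * u) ^+ n.
  by rewrite natrM natrX exprMn mulrA.
have [uh|uh] := ltP u 2^-1.
- apply: (@squeeze_cvgr _ _ _ _ (fun n => 1 - n%:R * (2 * u) ^+ n) (cst 1)).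
  + apply: nearW => n /=; apply/andP; split.
      rewrite -uE -mulrN; apply: bernoulli.
      by have := un n; lra.
    by apply: exprn_ile1; have := un n; lra.
  + rewrite -[X in _ --> X]subr0; apply: cvgB; first exact: cvg_cst.
    by apply: cvg_natM_expr; apply/andP; split; [rewrite mulr_gt0|rewrite -ltr_pdivlMl ?mulr1].
  + exact: cvg_cst.
- apply: (@squeeze_cvgr _ _ _ _ (cst 0) (fun n => n.+1%:R^-1)).
  + apply: nearW => n /=; apply/andP; split.
      by apply: exprn_ge0; have := un n; lra.
    apply: le_trans (bernoulli_inv _ (un n)) _.
    rewrite uE lef_pV2 ?posrE//; last first.
      by rewrite ltr_pwDl// mulr_ge0// exprn_ge0// mulr_ge0// ltW.
    rewrite -natr1 addrC lerD2l ler_peMr// exprn_ege1//.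
    by rewrite -ler_pdivrMl ?mulr1.
  + exact: cvg_cst.
  + exact: cvg_harmonic.
Qed.

End Bernoulli.

(** * The algebra of trigonometric polynomials *)

Section TrigPolynomials.
Variable R : realType.
Notation T := (lebesgueTypeR R).
Notation mu := (circle_measure R).
Notation e := (@expik R).
Notation bm := (@bounded_measurable R).
Notation cbm := (@complex_bm R).

(** A Laurent polynomial in [e 1 t], written as an ordinary polynomial over a power of [e 1 t];
    products then reduce to products in [{poly R[i]}]. *)
Definition trig_polynomial (f : R -> R[i]) :=
  exists (D : nat) (P : {poly R[i]}), f = fun t => e (- D%:Z) t * P.[e 1 t].

Lemma trig_cst c : trig_polynomial (fun=> c).
Proof.
exists 0%N, c%:P; apply/funext => t.
by rewrite oppr0 expik0 mul1r hornerC.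
Qed.

Lemma trig_mul f g : trig_polynomial f -> trig_polynomial g ->
  trig_polynomial (fun t => f t * g t).
Proof.
move=> [D [P ->]] [E [Q ->]]; exists (D + E)%N, (P * Q); apply/funext => t.
by rewrite hornerM PoszD opprD expikD; ring.
Qed.

Lemma expik_shift (D E : nat) t : e (- D%:Z) t = e (- (D + E)%:Z) t * e 1 t ^+ E.
Proof. by rewrite -expik_nat -expikD PoszD opprD subrK. Qed.

Lemma trig_add f g : trig_polynomial f -> trig_polynomial g ->
  trig_polynomial (fun t => f t + g t).
Proof.
move=> [D [P ->]] [E [Q ->]]; exists (D + E)%N, (P * 'X^E + Q * 'X^D).
apply/funext => t.
rewrite hornerD !hornerM !hornerXn (expik_shift D E) (expik_shift E D).
by rewrite [(E + D)%N]addnC; ring.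
Qed.

Lemma trig_opp f : trig_polynomial f -> trig_polynomial (fun t => - f t).
Proof.
move=> tf; rewrite (_ : (fun _ => _) = fun t => (-1) * f t).
  by apply: trig_mul => //; exact: trig_cst.
by apply/funext => t; rewrite mulN1r.
Qed.

Lemma trig_exp f n : trig_polynomial f -> trig_polynomial (fun t => f t ^+ n).
Proof.
move=> tf; elim: n => [|n IH]; first exact: trig_cst.
by under eq_fun do rewrite exprS; exact: trig_mul.
Qed.

Lemma trig_expik k : trig_polynomial (e k).
Proof.
case: k => n.
  exists 0%N, 'X^n; apply/funext => t.
  by rewrite oppr0 expik0 mul1r hornerXn -expik_nat.
by exists n.+1, 1%:P; apply/funext => t; rewrite hornerC mulr1 NegzE.
Qed.

Lemma trig_cos : trig_polynomial (fun t => (cos t)%:C).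
Proof.
rewrite (_ : (fun _ => _) = fun t => (2^-1)%:C * (e 1 t + e (-1) t)).
  by apply: trig_mul; [exact: trig_cst|apply: trig_add; exact: trig_expik].
apply/funext => t; rewrite /expik mulrN1z mulr1z mulN1r mul1r cosN sinN; simpc.
by congr (_ +i* _); lra.
Qed.

Lemma trig_sin : trig_polynomial (fun t => (sin t)%:C).
Proof.
rewrite (_ : (fun _ => _) = fun t => (0 -i* 2^-1) * (e 1 t - e (-1) t)).
  apply: trig_mul; first exact: trig_cst.
  by apply: trig_add; [|apply: trig_opp]; exact: trig_expik.
apply/funext => t; rewrite /expik mulrN1z mulr1z mulN1r mul1r cosN sinN; simpc.
by congr (_ +i* _); lra.
Qed.

Definition trig_real (p : R -> R) := trig_polynomial (fun t => (p t)%:C).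

Lemma trig_polynomialE f : trig_polynomial f -> exists (D W : nat) (g : nat -> R[i]),
  f = fun t => e (- D%:Z) t * \sum_(k < W) g k * e k%:Z t.
Proof.
move=> [D [P ->]]; exists D, (size P), (fun k => P`_k); apply/funext => t.
by rewrite horner_coef; under [in RHS]eq_bigr do rewrite expik_nat.
Qed.

Lemma cbm_trig_polynomial f : trig_polynomial f -> cbm f.
Proof.
move=> /trig_polynomialE[D [W [g ->]]].
by apply: cbmM; [exact: cbm_expik|exact: cbm_trig].
Qed.

Lemma bm_trig_real p : trig_real p -> bm p.
Proof. by move=> /cbm_trig_polynomial[]. Qed.

End TrigPolynomials.

(** * Indicators of measurable sets as limits of trigonometric polynomials *)

Section ApproximableSets.
Variable R : realType.
Notation T := (lebesgueTypeR R).
Notation mu := (circle_measure R).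
Notation e := (@expik R).
Notation bm := (@bounded_measurable R).
Notation cbm := (@complex_bm R).

Lemma trig_real_cst c : trig_real (fun=> c : R).
Proof. exact: trig_cst. Qed.

Lemma trig_realD (p q : R -> R) : trig_real p -> trig_real q ->
  trig_real (fun t => p t + q t).
Proof.
move=> tp tq; rewrite /trig_real.
by under eq_fun do rewrite rmorphD; exact: trig_add.
Qed.

Lemma trig_realM (p q : R -> R) : trig_real p -> trig_real q ->
  trig_real (fun t => p t * q t).
Proof.
move=> tp tq; rewrite /trig_real.
by under eq_fun do rewrite rmorphM; exact: trig_mul.
Qed.

Lemma trig_realN (p : R -> R) : trig_real p -> trig_real (fun t => - p t).
Proof.
move=> tp; rewrite /trig_real.
by under eq_fun do rewrite rmorphN; exact: trig_opp.
Qed.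

Lemma trig_realX (p : R -> R) n : trig_real p -> trig_real (fun t => p t ^+ n).
Proof.
move=> tp; rewrite /trig_real.
by under eq_fun do rewrite rmorphXn; exact: trig_exp.
Qed.

(** Approximation of the indicator in mean. The range [0, 1] of [p] makes the notion stable under
    products and lets the mean error control the mean square error. *)
Definition approximable (A : set R) := measurable (A : set T) /\
  forall eps : R, 0 < eps -> exists p : R -> R, [/\ trig_real p,
    forall t, 0 <= p t <= 1 & mean (fun t => `|\1_A t - p t|) <= eps].

Lemma indic_itv01 (A : set R) t : 0 <= (\1_A t : R) <= 1.
Proof. by rewrite indicE; case: (_ \in _); rewrite ?lexx ler01. Qed.

Lemma bm_dist_indic (A : set R) p : measurable (A : set T) -> trig_real p ->
  bm (fun t => `|\1_A t - p t|).
Proof.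
by move=> mA tp; apply/bm_norm/bmB; [exact: bm_indic|exact: bm_trig_real].
Qed.

Lemma approximable_limit (A : set R) (p_ : nat -> R -> R) :
  measurable (A : set T) -> (forall n, trig_real (p_ n)) ->
  (forall n t, 0 <= p_ n t <= 1) -> (forall t, p_ ^~ t @ \oo --> (\1_A t : R)) ->
  approximable A.
Proof.
move=> mA tp p01 cp; split => // eps eps0.
have h : (fun n => mean (fun t => `|\1_A t - p_ n t|)) @ \oo --> mean (fun=> 0 : R).
  apply: (@mean_cvg _ _ _ 1).
  - by move=> n; exact: bm_dist_indic.
  - exact: bm_cst.
  - move=> n t; rewrite normr_id ler_norml.
    by have := indic_itv01 A t; have := p01 n t; lra.
  - move=> t; rewrite -[X in _ --> X](@normr0 R R); apply: cvg_norm.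
    by rewrite -(subrr (\1_A t)); apply: cvgB; [exact: cvg_cst|exact: cp].
rewrite mean_cst in h; move/cvgrPdist_lt : h => /(_ _ eps0)[N _ /(_ N (leqnn N))].
rewrite sub0r normrN => hN; exists (p_ N); split => //.
by apply: ltW; apply: le_lt_trans hN; exact: ler_norm.
Qed.

Lemma approximableC (A : set R) : approximable A -> approximable (~` A).
Proof.
move=> [mA hA]; split; first exact: measurableC.
move=> eps /hA[p [tp p01 hp]]; exists (fun t => 1 - p t); split.
- by apply: trig_realD; [exact: trig_real_cst|exact: trig_realN].
- by move=> t; have := p01 t; lra.
- apply: le_trans hp; rewrite le_eqVlt; apply/orP; left; apply/eqP.
  apply: eq_mean => t; rewrite [RHS]distrC; congr `|_|.
  rewrite (_ : \1_(~` A) t = 1 - \1_A t); first by ring.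
  by rewrite !indicE in_setC; case: (_ \in _); rewrite /= ?subrr ?subr0.
Qed.

Lemma approximableI (A B : set R) : approximable A -> approximable B ->
  approximable (A `&` B).
Proof.
move=> [mA hA] [mB hB]; split; first exact: measurableI.
move=> eps eps0; have e20 : 0 < eps / 2 by rewrite divr_gt0.
have [p [tp p01 hp]] := hA _ e20; have [q [tq q01 hq]] := hB _ e20.
exists (fun t => p t * q t); split; first exact: trig_realM.
  move=> t; have /andP[p0 p1] := p01 t; have /andP[q0 q1] := q01 t.
  by rewrite mulr_ge0//= mulr_ile1.
have bA := bm_dist_indic mA tp; have bB := bm_dist_indic mB tq.
rewrite (splitr eps) (le_trans _ (lerD hp hq))// -meanD//.
apply: le_mean; [|exact: bmD|].
  by apply: bm_dist_indic; [exact: measurableI|exact: trig_realM].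
move=> t; rewrite indicI /=.
have := p01 t; have := q01 t; have := indic_itv01 A t; have := indic_itv01 B t.
set a := \1_A t; set b := \1_B t; move: (p t) (q t) => x y => b01 a01 y01 x01.
have -> : a * b - x * y = (a - x) * b + x * (b - y) by ring.
apply: le_trans (ler_normD _ _) _; rewrite !normrM lerD//.
  by rewrite ler_piMr// ger0_norm; lra.
by rewrite ler_piMl// ger0_norm; lra.
Qed.

Lemma approximable0 : approximable set0.
Proof.
split; first exact: measurable0.
move=> eps e0; exists (fun=> 0); split.
- exact: trig_real_cst.
- by move=> _; rewrite lexx ler01.
- under eq_mean do rewrite indic0 subrr normr0.
  by rewrite mean_cst ltW.
Qed.

Lemma approximableU (A B : set R) : approximable A -> approximable B ->
  approximable (A `|` B).
Proof.
move=> hA hB; rewrite -[_ `|` _]setCK setCU.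
by apply/approximableC/approximableI; exact: approximableC.
Qed.

(** Half of [eps] pays for replacing the union by a finite one, by dominated convergence, and half
    for approximating the finite union. *)
Lemma approximable_bigcup (F : nat -> set R) : (forall n, approximable (F n)) ->
  approximable (\bigcup_n F n).
Proof.
move=> hF; pose G n := \big[setU/set0]_(k < n) F k.
have hG n : approximable (G n).
  rewrite /G; elim: n => [|n IH]; first by rewrite big_ord0; exact: approximable0.
  by rewrite big_ord_recr; exact: approximableU.
have mF : measurable (\bigcup_n F n : set T).
  by apply: bigcupT_measurable => n; have [] := hF n.
split => // eps eps0; have e20 : 0 < eps / 2 by rewrite divr_gt0.
have h : (fun n => mean (fun t => `|\1_(\bigcup_n F n) t - \1_(G n) t : R|))
    @ \oo --> mean (fun=> 0 : R).
  apply: (@mean_cvg _ _ _ 1).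
  - by move=> n; apply/bm_norm/bmB; apply: bm_indic => //; have [] := hG n.
  - exact: bm_cst.
  - move=> n t; rewrite normr_id ler_norml.
    by have := indic_itv01 (\bigcup_n F n) t; have := indic_itv01 (G n) t; lra.
  (* At a fixed [t] the two indicators agree for all large [n]. *)
  - move=> t; apply: cvg_near_cst; rewrite /G.
    have [[k _ Fk]|nF] := pselect ((\bigcup_n F n) t).
      exists k.+1 => // n kn /=; rewrite -bigcup_mkord !indicE !mem_set ?subrr ?normr0//.
        by exists k.
      by exists k.
    apply: nearW => n; rewrite -bigcup_mkord !indicE !memNset ?subrr ?normr0//.
    by move=> [k _ Fk]; apply: nF; exists k.
rewrite mean_cst in h; move/cvgrPdist_lt : h => /(_ _ e20)[N _ /(_ N (leqnn N))].
rewrite sub0r normrN => /(le_lt_trans (ler_norm _))/ltW hN.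
have [mG /(_ _ e20)[p [tp p01 hp]]] := hG N.
exists p; split => //; rewrite (splitr eps) (le_trans _ (lerD hN hp))//.
rewrite -meanD; first last.
- exact: bm_dist_indic.
- by apply/bm_norm/bmB; exact: bm_indic.
apply: le_mean; first exact: bm_dist_indic.
  by apply: bmD; [apply/bm_norm/bmB; exact: bm_indic|exact: bm_dist_indic].
by move=> t; exact: ler_distD.
Qed.

Lemma approximable_null (A B N : set R) : approximable A ->
  measurable (B : set T) -> measurable (N : set T) -> mu N = 0%E ->
  (forall t, ~ N t -> (A t <-> B t)) -> approximable B.
Proof.
move=> [mA hA] mB mN N0 AB; split => // eps /hA[p [tp p01 hp]].
exists p; split => //; apply: le_trans hp.
have <- : mean (\1_N : R -> R) + mean (fun t => `|\1_A t - p t|) =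
    mean (fun t => `|\1_A t - p t|).
  suff -> : mean (\1_N : R -> R) = 0 by rewrite add0r.
  by have := probE mN; rewrite N0 => -[].
have bAp := bm_dist_indic mA tp.
rewrite -meanD//; last exact: bm_indic.
apply: le_mean; [exact: bm_dist_indic|by apply: bmD => //; exact: bm_indic|].
move=> t; rewrite !indicE; have [Nt|Nt] := pselect (N t).
  rewrite (mem_set Nt) ler_norml; have := p01 t.
  have := normr_ge0 ((t \in A)%:R - p t).
  by case: (t \in B) => /=; lra.
by rewrite (_ : (t \in B) = (t \in A)) ?lerDr//; apply/asboolP/asboolP => /AB; apply.
Qed.

(** The polynomials of [cvg_step_approx], composed with an affine function of [v], are trigonometric
    polynomials that converge to the indicator everywhere. *)
Lemma approximable_trig_lt0 (v : R -> R) : trig_real v -> continuous v ->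
  (forall t, `|v t| <= 2) -> approximable [set t | v t < 0].
Proof.
(* This puts [u] in [1/4, 3/4], with [u t < 1/2] exactly when [v t < 0]. *)
move=> tv cv v2; pose u t := 2^-1 + 8^-1 * v t.
have mv : measurable ([set t | v t < 0] : set T).
  apply: (@measurable_ltr R v (cst 0)); first exact: measurable_continuousT.
  exact: measurable_cst.
have tu : trig_real u.
  by apply: trig_realD; [|apply: trig_realM => //]; exact: trig_real_cst.
have u01 t : 0 < u t <= 1.
  by have := v2 t; rewrite ler_norml /u; lra.
apply: (@approximable_limit _ (fun n t => (1 - u t ^+ n) ^+ (n * 2 ^ n))) => //.
- move=> n; apply: trig_realX; apply: trig_realD; first exact: trig_real_cst.
  by apply: trig_realN; exact: trig_realX.
- move=> n t; have /andP[u0 u1] := u01 t.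
  have un0 : 0 <= u t ^+ n by rewrite exprn_ge0// ltW.
  have un1 : u t ^+ n <= 1 by rewrite exprn_ile1// ltW.
  by rewrite exprn_ge0 ?exprn_ile1//; lra.
- move=> t; rewrite indicE.
  rewrite (_ : (t \in _) = (u t < 2^-1)); first exact: cvg_step_approx.
  by apply/asboolP/idP => /=; rewrite /u; lra.
Qed.

Lemma approximable_cos_lt (a : R) : -1 <= a <= 1 -> approximable [set t | cos t < a].
Proof.
move=> a1; rewrite (_ : [set t | _] = [set t | cos t - a < 0]); last first.
  by apply/seteqP; split => t /=; lra.
apply: approximable_trig_lt0.
- by apply: trig_realD; [exact: trig_cos|exact: trig_real_cst].
- by move=> t; apply: cvgB; [exact: continuous_cos|exact: cvg_cst].
- by move=> t; rewrite ler_norml; have := cos_le1 t; have := cos_geN1 t; lra.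
Qed.

Lemma approximable_cos_gt (a : R) : -1 <= a <= 1 -> approximable [set t | a < cos t].
Proof.
move=> a1; rewrite (_ : [set t | _] = [set t | a - cos t < 0]); last first.
  by apply/seteqP; split => t /=; lra.
apply: approximable_trig_lt0.
- by apply: trig_realD; [exact: trig_real_cst|apply: trig_realN; exact: trig_cos].
- by move=> t; apply: cvgB; [exact: cvg_cst|exact: continuous_cos].
- by move=> t; rewrite ler_norml; have := cos_le1 t; have := cos_geN1 t; lra.
Qed.

Lemma approximable_sin_lt0 : approximable [set t : R | sin t < 0].
Proof.
apply: approximable_trig_lt0; [exact: trig_sin|exact: continuous_sin|].
by move=> t; rewrite ler_norml; have := sin_le1 t; have := sin_geN1 t; lra.
Qed.

Let D : set R := `[0, 2 * pi[%classic.

Lemma circle_measure_out : mu (~` D) = 0%E.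
Proof.
by rewrite circle_measureE [X in completed_lebesgue_measure X]setICl measure0 mule0.
Qed.

Lemma sin_lt0_period (t : R) : D t -> (sin t < 0) = (pi < t).
Proof.
rewrite /D /= in_itv/= => /andP[t0 t2].
have [tp|tp] := ltP pi t.
  have := @sin_gt0_pi R (t - pi).
  rewrite -[sin t](subrK 0).
  have -> : sin (t - pi) = - sin t.
    by rewrite -{2}(subrK pi t) sinDpi opprK.
  by rewrite subr0 addr0 oppr_gt0 => -> //; lra.
by apply/negbTE; rewrite -leNgt sin_ge0_pi// t0.
Qed.

(** Up to the null set outside [0, 2 pi), a ray is read off from sine and cosine: the sign of the
    sine tells the two half periods apart, and on each of them the cosine is monotone. *)
Lemma approximable_lt_ray (x : R) : measurable ([set t | t < x] : set T) ->
  approximable [set t | t < x].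
Proof.
move=> mx; have mD : measurable (~` D : set T).
  by apply: measurableC; exact: measurable_period.
have p0 := pi_gt0 R.
have cx : -1 <= cos x <= 1 by rewrite cos_geN1 cos_le1.
have hS := approximable_sin_lt0; have hP := approximableC hS.
have nn (P : Prop) : ~ ~ P -> P by move=> /contrapT.
have [x0|x0] := leP x 0.
  apply: (approximable_null approximable0 mx mD circle_measure_out) => t /nn.
  by rewrite /D /= in_itv /=; split => //; lra.
have [x2|x2] := leP (2 * pi) x.
  apply: (approximable_null (approximableC approximable0) mx mD circle_measure_out).
  by move=> t /nn; rewrite /D /= in_itv /=; split => //; lra.
have [xp|xp] := leP x pi.
  apply: (approximable_null (approximableI hP (approximable_cos_gt cx)) mx mD circle_measure_out).
  move=> t /nn Dt; rewrite /= (sin_lt0_period Dt).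
  move: Dt; rewrite /D /= in_itv /= => /andP[t0 t2].
  have [pt|pt] := ltP pi t; first by split; [case|lra].
  rewrite ltr_cos ?in_itv/=; [|lra|lra]. by split; [case|].
apply: (approximable_null (approximableU hP (approximable_cos_lt cx)) mx mD circle_measure_out).
move=> t /nn Dt; rewrite /= (sin_lt0_period Dt).
move: Dt; rewrite /D /= in_itv /= => /andP[t0 t2].
have [pt|pt] := ltP pi t; last by split; [lra|left].
have cos2 (y : R) : cos y = cos (2 * pi - y).
  by rewrite mulr_natl addrC cosD2pi cosN.
rewrite (cos2 t) (cos2 x) ltr_cos ?in_itv/=; [|lra|lra].
by rewrite ltrD2l ltrN2; split; [case|right].
Qed.

(** Approximable sets form a sigma-algebra containing the open left rays, hence all Borel sets; a
    Lebesgue-measurable set differs from a Borel set only inside a null Borel set. *)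
Lemma measurable_approximable (A : set T) : measurable A -> approximable A.
Proof.
have hB (B : set (measurableTypeR R)) : measurable B -> approximable B.
  rewrite [X in X -> _](_ : measurable B =
    (@RGenInftyO.G R).-sigma.-measurable B); last by rewrite -RGenInftyO.measurableE.
  move: B; apply: smallest_sub.
    split; [exact: approximable0| |exact: approximable_bigcup].
    by move=> B; rewrite setTD; exact: approximableC.
  move=> _ [x ->].
  have rayE : `]-oo, x[%classic = [set t | t < x].
    by apply/seteqP; split => t /=; rewrite in_itv.
  rewrite rayE; apply: approximable_lt_ray; rewrite -rayE.
  apply: sub_caratheodory.
  exact: (measurable_itv `]-oo, x[ : measurable (_ : set (measurableTypeR R))).
move=> mA; have : (completed_algebra_gen (@lebesgue_measure R)) A.
  by rewrite -g_sigma_completed_algebra_genE completed_caratheodory_measurable.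
move=> [/= B mB [N [M [mM M0 NM]]] BNA].
have mM' : measurable (M : set T) by exact: sub_caratheodory.
apply: (approximable_null (hB B mB) mA mM').
  apply/eqP; rewrite eq_le measure_ge0 andbT circle_measureE.
  rewrite mule_ge0_le0//.
    by rewrite lee_fin invr_ge0 ltW// pi2_gt0.
  rewrite -M0 -completed_lebesgue_measureE.
  apply: le_measure; rewrite ?inE//.
  by apply: measurableI => //; exact: measurable_period.
move=> t Mt; rewrite -BNA; split; first by left.
by case=> // /NM.
Qed.

End ApproximableSets.

(** * Density of trigonometric polynomials in mean square, and the Riemann-Lebesgue lemma *)

Section Density.
Variable R : realType.
Notation T := (lebesgueTypeR R).
Notation mu := (circle_measure R).
Notation e := (@expik R).
Notation bm := (@bounded_measurable R).
Notation cbm := (@complex_bm R).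

Lemma bmX (f : R -> R) n : bm f -> bm (fun t => f t ^+ n).
Proof.
move=> bf; elim: n => [|n IH]; first exact: bm_cst.
by under eq_fun do rewrite exprS; exact: bmM.
Qed.

Definition L2_trig_limit (f : R -> R) := bm f /\ forall eps : R, 0 < eps ->
  exists2 p, trig_real p & mean (fun t => (f t - p t) ^+ 2) <= eps.

Lemma L2_trig_limit_indic (A : set T) : measurable A -> L2_trig_limit (\1_A).
Proof.
move=> mA; split; first exact: bm_indic.
move=> eps eps0; have [_ /(_ _ eps0)[p [tp p01 hp]]] := measurable_approximable mA.
exists p => //; apply: le_trans hp; apply: le_mean.
- by apply/bmX/bmB; [exact: bm_indic|exact: bm_trig_real].
- by apply: bm_dist_indic.
- move=> t; rewrite -real_normK ?num_real// expr2 ler_piMr// ler_norml.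
  by have := indic_itv01 A t; have := p01 t; lra.
Qed.

Lemma L2_trig_limitD (f g : R -> R) : L2_trig_limit f -> L2_trig_limit g ->
  L2_trig_limit (fun t => f t + g t).
Proof.
move=> [bf hf] [bg hg]; split; first exact: bmD.
move=> eps eps0; have e40 : 0 < eps / 4 by rewrite divr_gt0.
have [p tp hp] := hf _ e40; have [q tq hq] := hg _ e40.
exists (fun t => p t + q t); first exact: trig_realD.
have bp := bm_trig_real tp; have bq := bm_trig_real tq.
have bfp := bmX 2 (bmB bf bp); have bgq := bmX 2 (bmB bg bq).
apply: (@le_trans _ _ (mean (fun t => 2 * (f t - p t) ^+ 2 + 2 * (g t - q t) ^+ 2))).
  apply: le_mean.
  - by apply: (bmX 2 (bmB (bmD bf bg) (bmD bp bq))).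
  - by apply: bmD; apply: bmM => //; exact: bm_cst.
  - move=> t; have := sqr_ge0 ((f t - p t) - (g t - q t)); nra.
rewrite (meanD (bmM (bm_cst _) bfp) (bmM (bm_cst _) bgq)).
by rewrite (meanZ _ bfp) (meanZ _ bgq); lra.
Qed.

Lemma L2_trig_limitZ (c : R) (f : R -> R) : L2_trig_limit f ->
  L2_trig_limit (fun t => c * f t).
Proof.
(* Dividing by [c ^+ 2 + 1] instead of [c ^+ 2] covers the case [c = 0]. *)
move=> [bf hf]; split; first by apply: bmM => //; exact: bm_cst.
move=> eps eps0; have c0 : 0 < c ^+ 2 + 1 by rewrite ltr_wpDl// sqr_ge0.
have [p tp hp] := hf (eps / (c ^+ 2 + 1)) (divr_gt0 eps0 c0).
exists (fun t => c * p t); first by apply: trig_realM => //; exact: trig_real_cst.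
rewrite (@eq_mean R _ (fun t => c ^+ 2 * (f t - p t) ^+ 2)); last first.
  by move=> t; ring.
rewrite meanZ; last by apply/bmX/bmB => //; exact: bm_trig_real.
move: hp; rewrite ler_pdivlMr// mulrDr mulr1 mulrC; apply: le_trans.
by rewrite lerDl mean_ge0// => t; exact: sqr_ge0.
Qed.

Lemma L2_trig_limit_cst (c : R) : L2_trig_limit (fun=> c).
Proof.
split; first exact: bm_cst.
move=> eps eps0; exists (fun=> c); first exact: trig_real_cst.
by under eq_mean do rewrite subrr expr0n; rewrite mean_cst ltW.
Qed.

Lemma L2_trig_limit_sum (F : nat -> R -> R) N : (forall k, L2_trig_limit (F k)) ->
  L2_trig_limit (fun t => \sum_(k < N) F k t).
Proof.
move=> hF; elim: N => [|N IH].
  by under eq_fun do rewrite big_ord0; exact: L2_trig_limit_cst.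
by under eq_fun do rewrite big_ord_recr; exact: L2_trig_limitD.
Qed.

Lemma L2_trig_limit_uniform (f : R -> R) : bm f ->
  (forall d : R, 0 < d -> exists2 g, L2_trig_limit g & forall t, `|f t - g t| <= d) ->
  L2_trig_limit f.
Proof.
move=> bf h; split => // eps eps0; have e40 : 0 < eps / 4 by rewrite divr_gt0.
have d0 : 0 < Num.sqrt (eps / 4) by rewrite sqrtr_gt0.
have [g [bg hg] fg] := h _ d0; have [p tp hp] := hg _ e40.
exists p => //; have bp := bm_trig_real tp.
have bgp := bmX 2 (bmB bg bp).
apply: (@le_trans _ _ (mean (fun t => eps / 2 + 2 * (g t - p t) ^+ 2))).
  apply: le_mean.
  - exact: (bmX 2 (bmB bf bp)).
  - by apply: bmD; [exact: bm_cst|apply: bmM => //; exact: bm_cst].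
  - move=> t; have := sqr_ge0 ((f t - g t) - (g t - p t)).
    have : (f t - g t) ^+ 2 <= eps / 4.
      rewrite -[leRHS]sqr_sqrtr ?(ltW e40)// -real_normK ?num_real//.
      by rewrite ler_pXn2r// nnegrE ltW.
    nra.
rewrite meanD; [|exact: bm_cst|by apply: bmM => //; exact: bm_cst].
by rewrite mean_cst meanZ//; lra.
Qed.

(** The sum counts the positive integers up to [x], so it is the integer part of [x]. *)
Lemma sum_floor (x : R) N : 0 <= x <= N%:R ->
  `|x - \sum_(k < N) (k.+1%:R <= x)%R%:R| <= 1.
Proof.
pose F k : R := (k.+1%:R <= x)%R%:R; rewrite -/(\sum_(k < N) F k).
have full M : M%:R <= x -> \sum_(k < M) F k = M%:R.
  move=> Mx; rewrite (eq_bigr (fun=> 1)) ?sumr_const ?card_ord// => k _.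
  by rewrite /F (le_trans _ Mx)// ler_nat.
elim: N => [|N IH] /andP[x0 xN].
  rewrite big_ord0 subr0; have -> : x = 0 by apply/eqP; rewrite eq_le x0 andbT.
  by rewrite normr0.
rewrite big_ord_recr/=.
have [xN'|xN'] := leP x N%:R.
  have h : (N.+1%:R <= x) = false.
    by apply: lt_geF; rewrite (le_lt_trans xN')// ltr_nat.
  by rewrite {2}/F h addr0 IH// x0.
rewrite (full _ (ltW xN')) /F -natr1 ler_norml.
rewrite -natr1 in xN.
have [h|h] := leP (N%:R + 1) x; apply/andP; split; rewrite /=; lra.
Qed.

(** Rescaled to [x = (f + M) / d], the function lies within 1 of its integer part, which is a finite
    sum of indicators of level sets; scaling back gives uniform error [d]. *)
Lemma bm_L2_trig_limit (f : R -> R) : bm f -> L2_trig_limit f.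
Proof.
move=> bf; apply: L2_trig_limit_uniform => // d d0.
have [mf [M hM]] := bf.
pose N := (Num.truncn (2 * M / d)).+1.
have M0 : 0 <= M by apply: le_trans (hM 0).
have hN : 2 * M / d <= N%:R by rewrite ltW// truncnS_gt.
pose x t := d^-1 * (f t + M).
exists (fun t => - M + d * \sum_(k < N) (k.+1%:R <= x t)%R%:R).
  apply: L2_trig_limitD; first exact: L2_trig_limit_cst.
  apply: L2_trig_limitZ; apply: (@L2_trig_limit_sum (fun k t => (k.+1%:R <= x t)%R%:R)) => k.
  have -> : (fun t => (k.+1%:R <= x t)%R%:R) = \1_([set t | k.+1%:R <= x t]) :> (R -> R).
    by apply/funext => t; rewrite indicE; congr (_%:R); congr nat_of_bool; apply/idP/asboolP.
  apply: L2_trig_limit_indic; apply: (@measurable_ler R (cst _)).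
    exact: measurable_cst.
  have [] : bm x by apply: bmM; [exact: bm_cst|apply: bmD => //; exact: bm_cst].
  by [].
move=> t; have := hM t; rewrite ler_norml => ft.
have -> : f t = - M + d * x t by rewrite /x mulVKf ?gt_eqF//; lra.
rewrite opprD addrACA subrr add0r -mulrBr normrM gtr0_norm// -[leRHS]mulr1.
rewrite ler_wpM2l ?(ltW d0)// sum_floor// /x; apply/andP; split.
  by rewrite mulr_ge0 ?invr_ge0 ?(ltW d0)//; lra.
apply: le_trans hN; rewrite mulrC ler_wpM2r ?invr_ge0 ?(ltW d0)//; lra.
Qed.

Lemma trig_density (f : R -> R[i]) (eps : R) : cbm f -> 0 < eps ->
  exists (D W : nat) (g : nat -> R[i]),
    mean (fun t => cabs (f t - e (- D%:Z) t * \sum_(k < W) g k * e k%:Z t) ^+ 2) <= eps.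
Proof.
move=> [fr fi] eps0; have e20 : 0 < eps / 2 by rewrite divr_gt0.
have [_ /(_ _ e20)[p tp hp]] := bm_L2_trig_limit fr.
have [_ /(_ _ e20)[q tq hq]] := bm_L2_trig_limit fi.
have tpq : trig_polynomial (fun t => (p t)%:C + 'i * (q t)%:C).
  by apply: trig_add => //; apply: trig_mul => //; exact: trig_cst.
have [D [W [g hg]]] := trig_polynomialE tpq.
exists D, W, g; rewrite (splitr eps); apply: le_trans (lerD hp hq).
rewrite -meanD; first last.
- by apply/bmX/bmB => //; exact: bm_trig_real.
- by apply/bmX/bmB => //; exact: bm_trig_real.
rewrite le_eqVlt; apply/orP; left; apply/eqP; apply: eq_mean => t.
have := congr1 (fun h => h t) hg => /= <-; rewrite sqr_cabs.
by case: (f t) => a b /=; rewrite !(mul0r, mul1r, addr0, add0r, subr0, mulr0).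
Qed.

Lemma le_amgm (x tau : R) : 0 < tau -> `|x| <= tau / 2 + (2 * tau)^-1 * x ^+ 2.
Proof.
move=> t0; rewrite -real_normK ?num_real//; set y := `|x|.
have -> : (2 * tau)^-1 = tau^-1 / 2 by rewrite invfM mulrC.
have := mulr_ge0 (ltW (_ : 0 < tau^-1 / 2)) (sqr_ge0 (y - tau)).
rewrite divr_gt0 ?invr_gt0// => /(_ isT).
have -> : tau^-1 / 2 * (y - tau) ^+ 2 = tau^-1 / 2 * y ^+ 2 - y + tau / 2.
  by field; rewrite gt_eqF.
by lra.
Qed.

(** The Cauchy-Schwarz inequality on a space of mass 1, obtained by integrating the
    arithmetic-geometric inequality with weight [tau]. *)
Lemma mean_norm_le (f : R -> R) (tau : R) : bm f -> 0 < tau ->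
  mean (fun t => f t ^+ 2) <= tau ^+ 2 -> mean (fun t => `|f t|) <= tau.
Proof.
move=> bf t0 h.
apply: (@le_trans _ _ (mean (fun t => tau / 2 + (2 * tau)^-1 * f t ^+ 2))).
  apply: le_mean => [||t]; [exact: bm_norm| |exact: le_amgm].
  by apply: bmD; [exact: bm_cst|apply: bmM; [exact: bm_cst|exact: bmX]].
rewrite meanD; [|exact: bm_cst|by apply: bmM; [exact: bm_cst|exact: bmX]].
rewrite mean_cst meanZ; last exact: bmX.
rewrite [leRHS](splitr tau) lerD2l.
have -> : tau / 2 = (2 * tau)^-1 * tau ^+ 2 by field; rewrite gt_eqF.
by rewrite ler_wpM2l// invr_ge0 mulr_ge0// ltW.
Qed.

(** Replace [f] by a trigonometric polynomial [p] within [tau] in mean square. Once [n] exceeds the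
    degree shift [D] of [p], every frequency [k + n - D] is positive and the mean of [p] against the
    cosine is exactly 0. *)
Lemma riemann_lebesgue (f : R -> R) (tau : R) : bm f -> 0 < tau ->
  exists N : nat, forall n, (N <= n)%N ->
    `|mean (fun t => f t * cos (n%:R * t))| <= tau.
Proof.
move=> bf t0; have t20 : 0 < tau ^+ 2 by rewrite exprn_gt0.
have [_ /(_ _ t20)[p tp hp]] := bm_L2_trig_limit bf.
have bp := bm_trig_real tp.
have [D [W [g hg]]] := trig_polynomialE tp.
exists D.+1 => n nD.
have bc : bm (fun t => cos (n%:R * t)) by exact: bm_cosM.
have bfp := bmB bf bp.
have -> : mean (fun t => f t * cos (n%:R * t)) =
    mean (fun t => (f t - p t) * cos (n%:R * t)) + mean (fun t => p t * cos (n%:R * t)).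
  by rewrite -meanD; [apply: eq_mean => t; ring|exact: bmM|exact: bmM].
have -> : mean (fun t => p t * cos (n%:R * t)) = 0.
  have hs t : p t * cos (n%:R * t) =
      \sum_(k < W) complex.Re (g k * e (k%:Z + (n%:Z - D%:Z)) t).
    have -> : p t * cos (n%:R * t) = complex.Re ((p t)%:C * e n%:Z t).
      by rewrite complex_ReM /= mul0r subr0.
    rewrite (congr1 (fun h => h t) hg : (p t)%:C = _) -mulrA mulrC -mulrA -expikD.
    rewrite big_distrl/= raddf_sum/=; apply: eq_bigr => k _.
    by rewrite [in RHS]expikD mulrA.
  rewrite (eq_mean hs) mean_sum; last first.
    by move=> k; case: (cbmM (cbm_cst (g k)) (cbm_expik R (k%:Z + (n%:Z - D%:Z)))).
  by rewrite big1// => k _; apply: mean_expik; lia.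
rewrite addr0; apply: le_trans (norm_mean (bmM bfp bc)) _.
apply: le_trans (mean_norm_le bfp t0 hp).
apply: le_mean; [exact: bm_norm (bmM bfp bc)|exact: bm_norm|] => t.
rewrite normrM ler_piMr// ler_norml; have := cos_le1 (n%:R * t).
by have := cos_geN1 (n%:R * t); lra.
Qed.

End Density.
(** * The stopped walk *)

Section StepBound.
Variable R : realType.

(** The quotient [G] of the two sides has derivative [- x ^+ 3 * expR (w x)], so it increases up to
    0, decreases afterwards, and its maximum is [G 0 = 1]. *)
Lemma le1Dx_expR3 (y : R) : 1 + y <= expR (y - y ^+ 2 / 2 + y ^+ 3 / 3).
Proof.
pose w (x : R) := - (x - x ^+ 2 / 2 + x ^+ 3 / 3).
pose G (x : R) := (1 + x) * expR (w x).
have dw (x : R) : is_derive x (1 : R) w (- (1 - x + x ^+ 2)).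
  rewrite /w; apply: is_derive_eq.
  by rewrite /GRing.scale /=; field.
have dG (x : R) : is_derive x (1 : R) G (- x ^+ 3 * expR (w x)).
  rewrite /G.
  have de := @is_derive1_comp _ expR w x _ _ (is_derive_expR (w x)) (dw x).
  apply: is_derive_eq.
  by rewrite /GRing.scale /=; ring.
suff : G y <= 1.
  rewrite /G /w expRN ler_pdivrMr ?expR_gt0// mul1r; exact.
have G0 : G 0 = 1 by rewrite /G /w !(expr0n, mul0r, subr0, addr0, oppr0) expR0 mulr1.
have cG : continuous G.
  by move=> t; apply/differentiable_continuous/derivable1_diffP; exact: ex_derive.
have [y0|y0|->] := ltgtP y 0; last by rewrite G0.
- have [c] := MVT y0 (fun x _ => dG x) (continuous_subspaceT cG).
  rewrite in_itv /= => /andP[yc c0]; rewrite G0 => h.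
  have : 0 <= - c ^+ 3 * expR (w c) * (0 - y).
    have c3 : 0 <= - c ^+ 3 by have := sqr_ge0 c; nra.
    by rewrite !mulr_ge0 ?expR_ge0// sub0r oppr_ge0 ltW.
  by rewrite -h subr_ge0.
- have [c] := MVT y0 (fun x _ => dG x) (continuous_subspaceT cG).
  rewrite in_itv /= => /andP[c0 cy]; rewrite G0 => h.
  have : - c ^+ 3 * expR (w c) * (y - 0) <= 0.
    by rewrite !mulNr oppr_le0 subr0 !mulr_ge0 ?expR_ge0 ?exprn_ge0// ltW.
  by rewrite -h subr_le0.
Qed.

Lemma sqr_cabs_step (a : R) k t :
  cabs (1 - a%:C * expik k t) ^+ 2 = 1 + a ^+ 2 - 2 * a * cos (k%:~R * t).
Proof.
have := cos2Dsin2 (k%:~R * t); rewrite sqr_cabs /expik.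
set c := cos _; set s := sin _ => cs.
have -> : 1 - a%:C * (c +i* s) = (1 - a * c) +i* - (a * s).
  by simpc.
rewrite /= ; transitivity (1 + a ^+ 2 * (c ^+ 2 + s ^+ 2) - 2 * a * c); first ring.
by rewrite cs mulr1.
Qed.

(** Apply [le1Dx_expR3] to the squared modulus [1 + y]. The second-order terms [a^2 - 2 a^2 cos^2]
    combine to [- a^2 cos (2 k t)], so no constant drift survives, as befits the harmonic function
    [log |1 - z|]; the other terms are at most [11 a^3] before halving. *)
Lemma cabs_step (a : R) k t : 0 <= a <= 1 ->
  cabs (1 - a%:C * expik k t) <=
  expR (- (a * cos (k%:~R * t) + a ^+ 2 / 2 * cos (2 * (k%:~R * t))) + 6 * a ^+ 3).
Proof.
move=> /andP[a0 a1].
rewrite -(ler_pXn2r (n := 2))// ?nnegrE ?cabs_ge0 ?expR_ge0//.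
rewrite -expRM_natl sqr_cabs_step.
rewrite [cos (2 * _)](_ : _ = 2 * cos (k%:~R * t) ^+ 2 - 1); last first.
  by rewrite mulr_natl cos_mulr2n mulr_natl.
have := cos_le1 (k%:~R * t); have := cos_geN1 (k%:~R * t).
set c := cos _ => cN1 c1.
pose y := a ^+ 2 - 2 * a * c.
rewrite (_ : 1 + _ - _ = 1 + y); last by rewrite /y; ring.
apply: le_trans (le1Dx_expR3 y) _; rewrite ler_expR.
have a20 : 0 <= a ^+ 2 by rewrite sqr_ge0.
have a30 : 0 <= a ^+ 3 by rewrite exprn_ge0.
have y3 : y <= 3 * a by rewrite /y; nra.
have : y ^+ 3 <= (3 * a) ^+ 3.
  have [y0|y0] := leP 0 y; first by rewrite ler_pXn2r ?nnegrE ?mulr_ge0.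
  apply: (@le_trans _ _ 0); last by rewrite exprn_ge0 ?mulr_ge0.
  by rewrite exprS mulr_le0_ge0 ?sqr_ge0// ltW.
have : a ^+ 3 * c <= a ^+ 3 by rewrite ler_piMr.
have : 0 <= a ^+ 4 by rewrite exprn_ge0.
have -> : y - y ^+ 2 / 2 + y ^+ 3 / 3 = a ^+ 2 - 2 * a * c - a ^+ 4 / 2 +
    2 * (a ^+ 3 * c) - 2 * (a ^+ 2 * c ^+ 2) + y ^+ 3 / 3 by rewrite /y; field.
by rewrite exprMn; lra.
Qed.

End StepBound.

(** * One-sided trigonometric sums and their splicing *)

Section PartialSums.
Variable R : realType.
Notation e := (@expik R).
Implicit Types g h : nat -> R[i].

Definition trig_sum g (N : nat) (t : R) : R[i] := \sum_(k < N) g k * e k%:Z t.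

Definition splice (p : nat) g h : nat -> R[i] :=
  fun k => if (p <= k)%N then h (k - p)%N else g k.

Lemma trig_sum_spliceL p g h N t : (N <= p)%N ->
  trig_sum (splice p g h) N t = trig_sum g N t.
Proof.
move=> Np; apply: eq_bigr => k _; rewrite /splice leqNgt.
by rewrite (leq_trans (ltn_ord k) Np).
Qed.

Lemma trig_sum_spliceR p g h m t :
  trig_sum (splice p g h) (p + m) t = trig_sum g p t + e p%:Z t * trig_sum h m t.
Proof.
rewrite /trig_sum big_split_ord/=; congr (_ + _).
  by apply: eq_bigr => k _; rewrite /splice leqNgt ltn_ord.
rewrite mulr_sumr; apply: eq_bigr => k _.
by rewrite /splice leq_addr addKn PoszD expikD mulrCA.
Qed.

Lemma trig_sum_stable g M N t : (forall k, (M <= k)%N -> g k = 0) ->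
  (M <= N)%N -> trig_sum g N t = trig_sum g M t.
Proof.
move=> g0 /subnKC <-; rewrite /trig_sum big_split_ord/= [X in _ + X]big1 ?addr0//.
by move=> k _; rewrite g0 ?mul0r// leq_addr.
Qed.

Lemma cbm_trig_sum g N : complex_bm (trig_sum g N).
Proof. exact: cbm_trig. Qed.

(** By Parseval both sides are sums of squared coefficients, and truncation only drops terms. This
    controls every partial sum of a block by the whole block. *)
Lemma mean_sqr_trig_sum_le g W m : (forall k, (W <= k)%N -> g k = 0) ->
  mean (fun t => cabs (trig_sum g m t) ^+ 2) <=
  mean (fun t => cabs (trig_sum g W t) ^+ 2).
Proof.
move=> g0; have [Wm|/ltnW mW] := leqP W m.
  by rewrite le_eqVlt; apply/orP; left; apply/eqP/eq_mean => t; rewrite (trig_sum_stable t g0 Wm).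
rewrite !parseval -(subnKC mW) big_split_ord/= lerDl.
by apply: sumr_ge0 => k _; exact: sqr_ge0.
Qed.

End PartialSums.

(** * First and second moments of the stopped walk *)

Section StoppedWalk.
Variable R : realType.
Notation T := (lebesgueTypeR R).
Notation bm := (@bounded_measurable R).
Variables A B : R.

Definition active (x : R) : R := ((- A < x) && (x < B))%:R.

(** The increment is the exponent of [cabs_step] without its cubic error, switched off once [X t]
    has left the interval. *)
Definition walk (X : R -> R) (a : R) (n : nat) : R -> R := fun t =>
  X t - active (X t) * (a * cos (n%:R * t) + a ^+ 2 / 2 * cos (2 * (n%:R * t))).

Lemma active01 x : 0 <= active x <= 1.
Proof. by rewrite /active; case: ((- A < x) && (x < B)); rewrite /= ?lexx ler01. Qed.

Lemma active_sqr x : active x ^+ 2 = active x.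
Proof. by rewrite /active; case: (_ && _); rewrite ?expr1n ?expr0n. Qed.

Lemma bm_active X : bm X -> bm (fun t => active (X t)).
Proof.
move=> bX; have mX := bm_measurable bX.
have -> : (fun t => active (X t)) =
    \1_([set t | - A < X t] `&` [set t | X t < B]) :> (R -> R).
  apply/funext => t; rewrite indicE /active; congr (_%:R); congr nat_of_bool.
  by apply/idP/asboolP => [/andP[]|[/= -> ->]].
apply: bm_indic; apply: measurableI.
  exact: (@measurable_ltr R (cst (- A)) X (measurable_cst _) mX).
exact: (@measurable_ltr R X (cst B) mX (measurable_cst _)).
Qed.

Lemma bm_cos_nat (n : nat) : bm (fun t => cos (n%:R * t)).
Proof. exact: bm_cosM. Qed.

Lemma bm_cos2_nat (n : nat) : bm (fun t => cos (2 * (n%:R * t))).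
Proof. by under eq_fun do rewrite mulrA; exact: bm_cosM. Qed.

Lemma bm_walk X a n : bm X -> bm (walk X a n).
Proof.
move=> bX; apply: (bmB bX (bmM (bm_active bX) (bmD _ _))).
  exact: (bmM (bm_cst a) (bm_cos_nat n)).
exact: (bmM (bm_cst (a ^+ 2 / 2)) (bm_cos2_nat n)).
Qed.

(** A step has length at most [a + a ^+ 2 / 2 < 1], and points outside the interval do not move, so
    the overshoot never exceeds 1. *)
Lemma walk_bounds X a n : 0 <= a <= 4^-1 -> 0 <= A -> 0 <= B ->
  (forall t, - A - 1 <= X t <= B + 1) ->
  forall t, - A - 1 <= walk X a n t <= B + 1.
Proof.
move=> /andP[a0 a4] A0 B0 hX t; have := hX t; rewrite /walk /active.
case: (boolP (- A < X t < B)) => [/andP[h1 h2]|_] /=; last by rewrite mul0r subr0.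
rewrite mul1r => _.
have := cos_le1 (n%:R * t); have := cos_geN1 (n%:R * t).
have := cos_le1 (2 * (n%:R * t)); have := cos_geN1 (2 * (n%:R * t)).
set c := cos _; set d := cos _ => d1 d2 c1 c2.
have := ler_wpM2l a0 c1; have := ler_wpM2l a0 c2.
have aa : 0 <= a ^+ 2 / 2 <= 4^-1 by rewrite divr_ge0 ?sqr_ge0//=; nra.
have /andP[aa0 aa1] := aa.
have := ler_wpM2l aa0 d1; have := ler_wpM2l aa0 d2.
by move: aa1; rewrite !mulrN1 !mulr1 => *; apply/andP; split; lra.
Qed.

Lemma active_walk X a n t : active (walk X a n t) <= active (X t).
Proof.
rewrite /walk; have := active01 (X t - active (X t) *
  (a * cos (n%:R * t) + a ^+ 2 / 2 * cos (2 * (n%:R * t)))).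
move=> /andP[h1 h2]; case: (boolP (- A < X t < B)) => h.
  by rewrite [leRHS]/active h.
have -> : active (X t) = 0 by rewrite /active (negbTE h).
by rewrite mul0r subr0 /active (negbTE h).
Qed.

Lemma cos_double (x : R) : cos x ^+ 2 = (1 + cos (2 * x)) / 2.
Proof. by rewrite mulr_natl cos_mulr2n mulr2n; lra. Qed.

(** An approximate form of the martingale property: [f] is almost orthogonal to both oscillations in
    the next increment. *)
Definition uncorrelated (tau : R) (f : R -> R) (n : nat) :=
  `|mean (fun t => f t * cos (n%:R * t))| <= tau /\
  `|mean (fun t => f t * cos (2 * (n%:R * t)))| <= tau.

Lemma uncorrelated_eventually (f : R -> R) (tau : R) : bm f -> 0 < tau ->
  exists N : nat, forall n, (N <= n)%N -> uncorrelated tau f n.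
Proof.
move=> bf t0; have [N hN] := riemann_lebesgue bf t0.
exists N => n nN; split; first exact: hN.
have h t : f t * cos (2 * (n%:R * t)) = f t * cos ((2 * n)%:R * t).
  by rewrite natrM mulrA.
by rewrite (eq_mean h); apply: hN; apply: (leq_trans nN); rewrite leq_pmull.
Qed.

Lemma walk_mean X a n (tau : R) : 0 <= a <= 4^-1 -> bm X ->
  uncorrelated tau (active \o X) n -> mean (walk X a n) <= mean X + tau.
Proof.
move=> /andP[a0 a4] bX [h1 h2]; have h1' := h1; have bA := bm_active bX.
have b1 := bmM bA (bm_cos_nat n); have b2 := bmM bA (bm_cos2_nat n).
have -> : mean (walk X a n) = mean X -
    (a * mean (fun t => active (X t) * cos (n%:R * t)) +
     a ^+ 2 / 2 * mean (fun t => active (X t) * cos (2 * (n%:R * t)))).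
  rewrite -(meanZ a b1) -(meanZ (a ^+ 2 / 2) b2).
  rewrite -(meanD (bmM (bm_cst a) b1) (bmM (bm_cst (a ^+ 2 / 2)) b2)).
  rewrite -(meanB bX (bmD (bmM (bm_cst a) b1) (bmM (bm_cst (a ^+ 2 / 2)) b2))).
  by apply: eq_mean => t; rewrite /walk; ring.
move: h1 h2; rewrite /=; set x := mean (fun t => _ * cos (n%:R * t)).
set y := mean (fun t => _ * cos (2 * _)).
rewrite !ler_norml => /andP[h1 _] /andP[h2 _].
have := ler_wpM2l a0 h1.
have aa0 : 0 <= a ^+ 2 / 2 by rewrite divr_ge0 ?sqr_ge0.
have := ler_wpM2l aa0 h2.
have t0 : 0 <= tau.
  by apply: le_trans h1'; exact: normr_ge0.
have := mulr_ge0 a0 t0; have : a * tau <= 4^-1 * tau by rewrite ler_wpM2r.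
have : a ^+ 2 / 2 * tau <= 4^-1 * tau by rewrite ler_wpM2r//; nra.
by lra.
Qed.

(** In the expanded square the cross terms and the oscillating half of [a^2 cos^2] cost at most
    [tau] together. The constant half contributes [a ^+ 2 / 2] on the active set, of which
    [a ^+ 2 / 4] is given up to absorb the cubic term. *)
Lemma walk_sqr X a n (tau : R) : 0 <= a <= 4^-1 -> bm X -> 0 <= tau ->
  uncorrelated tau (active \o X) n ->
  uncorrelated tau (fun t => X t * active (X t)) n ->
  mean (fun t => X t ^+ 2) + a ^+ 2 / 4 * mean (active \o X) - tau <=
  mean (fun t => walk X a n t ^+ 2).
Proof.
move=> /andP[a0 a4] bX t0 [_ h2] [h3 h4]; have bA := bm_active bX.
have b2 := bmM bA (bm_cos2_nat n); have bXA := bmM bX bA.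
have b3 := bmM bXA (bm_cos_nat n); have b4 := bmM bXA (bm_cos2_nat n).
have bX2 := bmX 2 bX; have bA' : bm (active \o X) := bA.
(* [c1] and [c2] come from the cross terms, [c4] from the oscillating half of [a^2 cos^2], and [c3]
   is what is kept of its constant half. *)
pose c1 := - (2 * a); pose c2 := - a ^+ 2; pose c3 := a ^+ 2 / 4; pose c4 := a ^+ 2 / 2.
apply: (@le_trans _ _ (mean (fun t => X t ^+ 2 +
  (c1 * (X t * active (X t) * cos (n%:R * t)) +
  (c2 * (X t * active (X t) * cos (2 * (n%:R * t))) +
  (c3 * (active \o X) t + c4 * (active (X t) * cos (2 * (n%:R * t))))))))).
  rewrite (meanD bX2 (bmD (bmM (bm_cst c1) b3) (bmD (bmM (bm_cst c2) b4) (bmD (bmM (bm_cst c3) bA') (bmM (bm_cst c4) b2))))).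
  rewrite (meanD (bmM (bm_cst c1) b3) (bmD (bmM (bm_cst c2) b4) (bmD (bmM (bm_cst c3) bA') (bmM (bm_cst c4) b2)))).
  rewrite (meanD (bmM (bm_cst c2) b4) (bmD (bmM (bm_cst c3) bA') (bmM (bm_cst c4) b2))).
  rewrite (meanD (bmM (bm_cst c3) bA') (bmM (bm_cst c4) b2)).
  rewrite (meanZ c1 b3) (meanZ c2 b4) (meanZ c3 bA') (meanZ c4 b2).
  move: h2 h3 h4; rewrite /=.
  set x2 := mean (fun t => active (X t) * cos (2 * _)).
  set x3 := mean (fun t => _ * cos (n%:R * t)).
  set x4 := mean (fun t => X t * _ * cos (2 * _)).
  rewrite !ler_norml => /andP[h2 _] /andP[_ h3] /andP[_ h4].
  have aa0 : 0 <= a ^+ 2 by rewrite sqr_ge0.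
  have aa1 : a ^+ 2 <= 16^-1 by nra.
  have := ler_wpM2l a0 h3; have := ler_wpM2l aa0 h2; have := ler_wpM2l aa0 h4.
  have : a * tau <= 4^-1 * tau by rewrite ler_wpM2r.
  have : a ^+ 2 * tau <= 16^-1 * tau by rewrite ler_wpM2r.
  rewrite /c1 /c2 /c3 /c4; set z := mean (fun=> _); lra.
apply: le_mean.
- exact: (bmD bX2 (bmD (bmM (bm_cst c1) b3) (bmD (bmM (bm_cst c2) b4) (bmD (bmM (bm_cst c3) bA') (bmM (bm_cst c4) b2))))).
- exact: (bmX 2 (bm_walk a n bX)).
- move=> t; rewrite /walk /=.
  have cd := cos_double (n%:R * t).
  have := cos_le1 (n%:R * t); have := cos_geN1 (n%:R * t).
  have := cos_le1 (2 * (n%:R * t)); have := cos_geN1 (2 * (n%:R * t)).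
  move: cd; set c := cos _; set d := cos _ => cd d1 d2 k1 k2.
  have := active01 (X t); have := active_sqr (X t).
  set x := X t; set s := active x => ss /andP[s0 s1].
  have -> : (x - s * (a * c + a ^+ 2 / 2 * d)) ^+ 2 =
    x ^+ 2 - 2 * x * s * (a * c + a ^+ 2 / 2 * d) +
    s ^+ 2 * (a ^+ 2 * c ^+ 2 + a ^+ 3 * (c * d) + a ^+ 4 / 4 * d ^+ 2) by field.
  rewrite ss cd /c1 /c2 /c3 /c4.
  have cdN1 : -1 <= c * d by nra.
  have a30 : 0 <= a ^+ 3 by rewrite exprn_ge0.
  have a34 : a ^+ 3 <= a ^+ 2 / 4.
    by rewrite exprSr ler_wpM2l ?sqr_ge0.
  have := ler_wpM2l a30 cdN1.
  have a44 : 0 <= a ^+ 4 / 4 * d ^+ 2.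
    by rewrite mulr_ge0 ?sqr_ge0// divr_ge0// exprn_ge0.
  move=> hcd.
  have : 0 <= s * (a ^+ 3 * (c * d) + a ^+ 4 / 4 * d ^+ 2 + a ^+ 2 / 4).
    by rewrite mulr_ge0//; lra.
  by lra.
Qed.

End StoppedWalk.

(** A segment of [M + W + 1] integers in [L] starts at a positive integer; dropping its first [M]
    elements leaves a long enough segment beyond [M]. *)
Lemma long_segments_nat (L : set int) : (forall k : int, L k -> 0 < k) ->
  has_long_segments L -> forall M W : nat, exists p : nat, (M <= p)%N /\
    forall k, (k < W)%N -> L (p + k)%:Z.
Proof.
move=> Lpos Lseg M W; have [//|a ha] := Lseg (M + W).+1.
have := Lpos _ (ha 0%N isT); rewrite addr0; case: a ha => // a ha _.
exists (a + M)%N; split; first exact: leq_addl.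
by move=> k kW; rewrite -addnA PoszD; apply: ha; lia.
Qed.

(** * One step of the walk, realized with frequencies in [L] *)

Section ApproximationStep.
Variable R : realType.
Notation e := (@expik R).
Notation bm := (@bounded_measurable R).
Notation cbm := (@complex_bm R).

Lemma mean_cabsD (f g : R -> R[i]) : cbm f -> cbm g ->
  mean (fun t => cabs (f t + g t)) <=
  mean (fun t => cabs (f t)) + mean (fun t => cabs (g t)).
Proof.
move=> bf bg; rewrite -(meanD (bm_cabs bf) (bm_cabs bg)).
apply: le_mean; [exact: bm_cabs (cbmD bf bg)|exact: (bmD (bm_cabs bf) (bm_cabs bg))|].
by move=> t; exact: cabsD.
Qed.

Lemma mean_cabs_le (f : R -> R[i]) (tau : R) : cbm f -> 0 < tau ->
  mean (fun t => cabs (f t) ^+ 2) <= tau ^+ 2 ->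
  mean (fun t => cabs (f t)) <= tau.
Proof.
move=> bf t0 /(mean_norm_le (bm_cabs bf) t0); apply: le_trans.
by rewrite le_eqVlt; apply/orP; left; apply/eqP/eq_mean => t; rewrite ger0_norm ?cabs_ge0.
Qed.

Variables (L : set int) (f : R -> R[i]) (A B a tau theta : R) (M : nat).

(* [X] is the stopped walk and [rho] the idealized residual after [j] steps; the
   true residual [f - trig_sum g M'] differs from [rho] only by the errors of the
   [L^2] approximations. *)
Record walk_state (j : nat) (X : R -> R) (rho : R -> R[i]) (g : nat -> R[i])
    (M' : nat) : Prop := WalkState {
  state_bm : bm X;
  state_cbm : cbm rho;
  state_bounds : forall t, - A - 1 <= X t <= B + 1;
  state_rho : forall t, cabs (rho t) <= cabs (f t) * expR (X t + 6 * (j%:R * a ^+ 3));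
  state_mean : mean X <= j%:R * tau;
  state_sqr : j%:R * (a ^+ 2 / 4) * mean (active A B \o X) - j%:R * tau <=
    mean (fun t => X t ^+ 2);
  state_supp : forall k, g k != 0 -> (M <= k < M')%N /\ L k%:Z;
  state_err : mean (fun t => cabs (f t - trig_sum g M' t - rho t)) <= j%:R * tau;
  state_partial : forall N, exists rho' : R -> R[i],
    [/\ cbm rho', forall t, cabs (rho' t) <= expR (B + 7) * cabs (f t) &
      mean (fun t => cabs (f t - trig_sum g N t - rho' t)) <= theta] }.

Lemma walk_state0 : 0 <= A -> 0 <= B -> 0 < theta -> cbm f ->
  walk_state 0 (fun=> 0) f (fun=> 0) M.
Proof.
move=> A0 B0 theta0 bf.
have sum0 N t : trig_sum (fun=> 0 : R[i]) N t = 0.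
  by rewrite /trig_sum big1// => k _; rewrite mul0r.
have err0 N : mean (fun t => cabs (f t - trig_sum (fun=> 0 : R[i]) N t - f t)) = 0.
  rewrite -[RHS](mean_cst 0); apply: eq_mean => t.
  by rewrite sum0 subr0 subrr cabs0.
split.
- exact: bm_cst.
- exact: bf.
- by move=> _; apply/andP; split; lra.
- by move=> t; rewrite mul0r mulr0 addr0 expR0 mulr1.
- by rewrite mean_cst mul0r.
- by rewrite !mul0r subr0 mean_ge0// => t; exact: sqr_ge0.
- by move=> k; rewrite eqxx.
- by rewrite err0 mul0r.
- move=> N; exists f; split => [//|t|].
    rewrite ler_peMl ?cabs_ge0// -[leLHS]expR0 ler_expR; lra.
  by rewrite err0 ltW.
Qed.

(** The ideal increment is [phi * e n]. If [phi] is close to [e (- D)] times a polynomial [S W] with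
    frequencies in [0, W), then with [n = p + D] the increment is close to [e p * S W], whose
    frequencies fill a segment of [L] starting at [p]. The next state uses this block after [g]. *)
Lemma walk_state_step (H : R) j X rho g M' :
  (forall M W : nat, exists p : nat, (M <= p)%N /\
    forall k, (k < W)%N -> L (p + k)%:Z) ->
  0 <= A -> 0 <= B -> 0 <= a <= 4^-1 -> 0 < tau -> 0 < theta ->
  cbm f -> (forall t, cabs (f t) <= H) ->
  2 * (a * (expR (B + 7) * H)) ^+ 2 + 2 * tau ^+ 2 <= (theta / 2) ^+ 2 ->
  (M <= M')%N -> j.+1%:R * a ^+ 3 <= 1 ->
  j%:R * tau <= theta / 2 -> walk_state j X rho g M' ->
  exists X' rho' g' M'', (M' <= M'')%N /\ walk_state j.+1 X' rho' g' M''.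
Proof.
move=> Lseg A0 B0 a04 tau0 theta0 bf fH small MM' ja jtau [bX brho Xb rhob Xm Xs gs gerr gpart].
have /andP[a0 a4] := a04.
have a30 : 0 <= a ^+ 3 by rewrite exprn_ge0.
have H0 : 0 <= H by apply: le_trans (fH 0); exact: cabs_ge0.
have bchi := bm_active A B bX.
pose phi t := (a * active A B (X t))%:C * rho t.
have bphi : cbm phi := cbmM (cbm_real (bmM (bm_cst a) bchi)) brho.
(* The constant 7 is the overshoot 1 plus the accumulated cubic errors, at most 6. *)
have rhoK t : cabs (rho t) <= expR (B + 7) * cabs (f t).
  apply: le_trans (rhob t) _; rewrite mulrC ler_wpM2r ?cabs_ge0// ler_expR.
  have /andP[_ X2] := Xb t.
  have : j%:R * a ^+ 3 <= 1.
    by apply: le_trans ja; rewrite ler_wpM2r// ler_nat.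
  lra.
have phiK t : cabs (phi t) <= a * (expR (B + 7) * H).
  rewrite /phi cabsM cabsR; have /andP[x0 x1] := active01 A B (X t).
  rewrite ger0_norm ?mulr_ge0// -mulrA ler_wpM2l//.
  apply: (@le_trans _ _ (cabs (rho t))); first by rewrite ler_piMl ?cabs_ge0.
  by apply: le_trans (rhoK t) _; rewrite ler_wpM2l ?expR_ge0.
have [D [W [g0 hg0]]] := trig_density bphi (exprn_gt0 2 tau0).
pose h k := if (k < W)%N then g0 k else 0.
have h0 k : (W <= k)%N -> h k = 0 by rewrite /h ltnNge => ->.
have g00 k : (M' <= k)%N -> g k = 0.
  by move=> Mk; apply/eqP/negPn/negP => /gs[/andP[_]]; rewrite ltnNge Mk.
pose S m := trig_sum h m.
have bS m : cbm (S m) := cbm_trig_sum h m.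
have beS m k : cbm (fun t => e k t * S m t) := cbmM (cbm_expik R k) (bS m).
pose dlt t := phi t - e (- D%:Z) t * S W t.
have bdlt : cbm dlt := cbmB bphi (beS W (- D%:Z)).
have hdlt2 : mean (fun t => cabs (dlt t) ^+ 2) <= tau ^+ 2.
  apply: le_trans hg0; rewrite le_eqVlt; apply/orP; left; apply/eqP/eq_mean => t.
  rewrite /dlt /S /trig_sum; congr (cabs (_ - _ * _) ^+ 2).
  by apply: eq_bigr => k _; rewrite /h ltn_ord.
have hdlt := mean_cabs_le bdlt tau0 hdlt2.
have [N1 hN1] := uncorrelated_eventually bchi tau0.
have [N2 hN2] := uncorrelated_eventually (bmM bX bchi) tau0.
(* [p] lies beyond the old block, so that the blocks are disjoint, and beyond [N1] and [N2], so that
   [n] is uncorrelated with both functions of the walk. *)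
have [p [pM hp]] := Lseg (M' + N1 + N2) W.
have [Mp nN1 nN2] : [/\ M' <= p, N1 <= p + D & N2 <= p + D]%N.
  by split; move: pM; clear; lia.
pose n := (p + D)%N.
have sumgp t : trig_sum g p t = trig_sum g M' t by exact: trig_sum_stable.
have bres : cbm (fun t => f t - trig_sum g M' t - rho t).
  exact: (cbmB (cbmB bf (cbm_trig_sum g M')) brho).
exists (walk A B X a n), (fun t => rho t - phi t * e n%:Z t), (splice p g h), (p + W)%N.
split; first exact: leq_trans Mp (leq_addr W p).
split.
- exact: bm_walk.
- exact: (cbmB brho (cbmM bphi (cbm_expik R n%:Z))).
- exact: walk_bounds.
- move=> t.
  have -> : rho t - phi t * e n%:Z t =
      rho t * (1 - (a * active A B (X t))%:C * e n%:Z t) by rewrite /phi; ring.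
  rewrite cabsM.
  have st : cabs (1 - (a * active A B (X t))%:C * e n%:Z t) <=
      expR (walk A B X a n t - X t + 6 * a ^+ 3).
    (* At active points this is [cabs_step]; at stopped points the factor is 1 and the walk is at
       rest. *)
    rewrite /walk /active; case: (_ < _ < _) => /=.
      have a01 : 0 <= a <= 1 by rewrite a0 (le_trans a4)// invf_le1// ler1n.
      rewrite mulr1 mul1r; apply: le_trans (cabs_step n%:Z t a01) _.
      by rewrite ler_expR [X in _ <= X + _]addrAC subrr sub0r.
    rewrite mulr0 mul0r !subr0 mul0r subr0 subrr add0r.
    by rewrite (cabsR 1) normr1 -[leLHS]expR0 ler_expR mulr_ge0.
  apply: le_trans (ler_pM (cabs_ge0 _) (cabs_ge0 _) (rhob t) st) _.
  rewrite -mulrA -expRD ler_wpM2l ?cabs_ge0// ler_expR -natr1; lra.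
- rewrite -natr1 mulrDl mul1r; apply: le_trans (lerD Xm (lexx tau)).
  by apply: walk_mean => //; exact: hN1.
- have hw := walk_sqr a04 bX (ltW tau0) (hN1 _ nN1) (hN2 _ nN2).
  apply: le_trans hw.
  (* The active set shrinks, so the bound for the earlier steps survives with the new, smaller mean
     in place of the old one. *)
  apply: (@le_trans _ _ (j.+1%:R * (a ^+ 2 / 4) * mean (active A B \o X) - j.+1%:R * tau)).
    rewrite lerD2r ler_wpM2l//.
      by rewrite mulr_ge0// divr_ge0// sqr_ge0.
    apply: le_mean; [exact: (bm_active A B (bm_walk A B a n bX))|exact: bchi|].
    by move=> t; exact: active_walk.
  by rewrite -natr1; lra.
- move=> k; rewrite /splice; have [pk|pk] := leqP p k.
    have [kW _|kW] := ltnP (k - p)%N W; last by rewrite (h0 _ kW) eqxx.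
    have := hp _ kW; rewrite subnKC// => Lk; split; last exact: Lk.
    by move: MM' Mp pk kW; clear; lia.
  move=> /gs[/andP[Mk kM] Lk]; split; last exact: Lk.
  by rewrite Mk (leq_trans kM (leq_trans Mp (leq_addr W p))).
- have -> : mean (fun t => cabs (f t - trig_sum (splice p g h) (p + W) t -
      (rho t - phi t * e n%:Z t))) =
      mean (fun t => cabs ((f t - trig_sum g M' t - rho t) + e n%:Z t * dlt t)).
    apply: eq_mean => t; rewrite trig_sum_spliceR sumgp /dlt /S.
    have -> : e p%:Z t = e n%:Z t * e (- D%:Z) t.
      by rewrite -expikD /n PoszD addrK.
    by congr cabs; ring.
  apply: le_trans (mean_cabsD bres (cbmM (cbm_expik R n%:Z) bdlt)) _.
  rewrite -natr1 mulrDl mul1r lerD//; apply: le_trans hdlt.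
  rewrite le_eqVlt; apply/orP; left; apply/eqP/eq_mean => t.
  by rewrite cabsM cabs_expik mul1r.
(* Up to [p] the partial sums are the old ones. Beyond [p], take [rho' = rho]: the old error and the
   partial sum of the new block each get half of [theta]. *)
- move=> N; have [Np|/ltnW pN] := leqP N p.
    have [rho' [b1 b2 b3]] := gpart N; exists rho'; split => //.
    rewrite (@eq_mean R _ (fun t => cabs (f t - trig_sum g N t - rho' t)))// => t.
    by rewrite trig_sum_spliceL.
  exists rho; split => //; rewrite -(subnKC pN); set m := (N - p)%N.
  have -> : mean (fun t => cabs (f t - trig_sum (splice p g h) (p + m) t - rho t)) =
      mean (fun t => cabs ((f t - trig_sum g M' t - rho t) + - (e p%:Z t * S m t))).
    apply: eq_mean => t; rewrite trig_sum_spliceR sumgp /S.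
    by congr cabs; ring.
  apply: le_trans (mean_cabsD bres (cbmN (beS m p%:Z))) _.
  rewrite (splitr theta) lerD//; first exact: le_trans gerr jtau.
  have t20 : 0 < theta / 2 by rewrite divr_gt0.
  apply: (mean_cabs_le (cbmN (beS m p%:Z)) t20).
  have -> : mean (fun t => cabs (- (e p%:Z t * S m t)) ^+ 2) =
      mean (fun t => cabs (S m t) ^+ 2).
    by apply: eq_mean => t; rewrite cabsN cabsM cabs_expik mul1r.
  apply: le_trans (mean_sqr_trig_sum_le m h0) _; apply: le_trans small.
  (* The whole block has the modulus of [phi - dlt], where [phi] is of order [a] and [dlt] is the
     approximation error. *)
  apply: (@le_trans _ _ (mean (fun t => 2 * (a * (expR (B + 7) * H)) ^+ 2 +
      2 * cabs (dlt t) ^+ 2))).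
    apply: le_mean.
    + exact: (bm_sqr_cabs (bS W)).
    + exact: (bmD (bm_cst _) (bmM (bm_cst 2) (bm_sqr_cabs bdlt))).
    + move=> t.
      have -> : cabs (trig_sum h W t) = cabs (phi t + - dlt t).
        by rewrite /dlt opprB addrC subrK cabsM cabs_expik mul1r.
      apply: le_trans (sqr_cabsD _ _) _; rewrite cabsN lerD2r ler_wpM2l//.
      by rewrite ler_pXn2r ?nnegrE ?cabs_ge0 ?mulr_ge0 ?expR_ge0.
  have bd2 := bm_sqr_cabs bdlt.
  rewrite (meanD (bm_cst _) (bmM (bm_cst 2) bd2)) mean_cst (meanZ 2 bd2).
  by rewrite lerD2l ler_wpM2l.
Qed.

End ApproximationStep.

(** * Running the walk until almost every point has stopped *)

Section Approximation.
Variable R : realType.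
Notation T := (lebesgueTypeR R).
Notation e := (@expik R).
Notation bm := (@bounded_measurable R).
Notation cbm := (@complex_bm R).

Lemma prob_le_mean (E : set R) (F : R -> R) : measurable (E : set T) -> bm F ->
  (forall t, 0 <= F t) -> (forall t, E t -> 1 <= F t) -> prob E <= mean F.
Proof.
move=> mE bF F0 F1; apply: (le_mean (bm_indic mE) bF) => t.
rewrite indicE; have [Et|Et] := pselect (E t).
  by rewrite (mem_set Et); exact: F1.
by rewrite (memNset Et).
Qed.

Lemma walk_iterate (L : set int) (f : R -> R[i]) (A B a tau theta H : R) (M J : nat) :
  (forall M W : nat, exists p : nat, (M <= p)%N /\
    forall k, (k < W)%N -> L (p + k)%:Z) ->
  0 <= A -> 0 <= B -> 0 <= a <= 4^-1 -> 0 < tau -> 0 < theta ->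
  cbm f -> (forall t, cabs (f t) <= H) ->
  2 * (a * (expR (B + 7) * H)) ^+ 2 + 2 * tau ^+ 2 <= (theta / 2) ^+ 2 ->
  J%:R * a ^+ 3 <= 1 -> J%:R * tau <= theta / 2 ->
  exists X rho g M', (M <= M')%N /\ walk_state L f A B a tau theta M J X rho g M'.
Proof.
move=> Lseg A0 B0 a04 tau0 theta0 bf fH small.
have /andP[a0 _] := a04.
elim: J => [|J IH] Ja Jt.
  exists (fun=> 0), f, (fun=> 0), M; split; first exact: leqnn.
  exact: walk_state0.
have JJ : J%:R <= J.+1%:R :> R by rewrite ler_nat.
have [||X [rho [g [M' [MM' st]]]]] := IH.
- by apply: le_trans Ja; rewrite ler_wpM2r// exprn_ge0.
- by apply: le_trans Jt; rewrite ler_wpM2r// ltW.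
have Jt' : J%:R * tau <= theta / 2.
  by apply: le_trans Jt; rewrite ler_wpM2r// ltW.
have [X' [rho' [g' [M'' [MM'' st']]]]] :=
  walk_state_step Lseg A0 B0 a04 tau0 theta0 bf fH small MM' Ja Jt' st.
by exists X', rho', g', M''; split => //; exact: leq_trans MM' MM''.
Qed.

Lemma measurable_cabs_lt (f g : R -> R[i]) (c d : R) : cbm f -> cbm g ->
  measurable ([set t | c * cabs (f t) + d < cabs (g t)] : set T).
Proof.
move=> bf bg; apply: (@measurable_ltr R (fun t => c * cabs (f t) + d)).
  exact: (bm_measurable (bmD (bmM (bm_cst c) (bm_cabs bf)) (bm_cst d))).
exact: (bm_measurable (bm_cabs bg)).
Qed.

(** With [a = 1/m] and [J = m^3] steps, [J a^3 = 1] keeps the cubic errors bounded, while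
    [J a^2 = m] would force a large second moment unless the active set were small. A stopped point
    either lies below [- A], where the residual is at most [expR (6 - A) * cabs (f t)], or above
    [B], which Markov's inequality for [X + A + 1] makes unlikely. *)
Lemma walk_approximation (L : set int) (f : R -> R[i]) (A B eta H : R) (M : nat) :
  (forall M W : nat, exists p : nat, (M <= p)%N /\
    forall k, (k < W)%N -> L (p + k)%:Z) ->
  0 <= A -> 0 < B -> 0 < eta -> cbm f -> (forall t, cabs (f t) <= H) ->
  exists (g : nat -> R[i]) (M' : nat),
  [/\ (M <= M')%N,
      forall k, g k != 0 -> (M <= k < M')%N /\ L k%:Z,
      prob [set t | expR (6 - A) * cabs (f t) + eta < cabs (f t - trig_sum g M' t)]
        <= (A + 2) / B + eta &
      forall N, prob [set t | expR (B + 7) * cabs (f t) + eta <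
        cabs (f t - trig_sum g N t)] <= eta].
Proof.
move=> Lseg A0 B0 eta0 bf fH.
(* A mean error [theta] exceeds [eta] with probability at most [theta / eta = eta]. *)
pose theta := eta ^+ 2; have theta0 : 0 < theta by rewrite exprn_gt0.
pose K := expR (B + 7).
(* [m] above [c1] makes the final active set have probability at most [eta / 2]; above [c2] it makes
   the norm of each block small enough for [small]; above 4 it gives [a <= 4^-1]. *)
pose c1 := 8 * ((A + B + 1) ^+ 2 + 1) / eta.
pose c2 := 16 * (K * H) ^+ 2 / theta ^+ 2.
have c10 : 0 <= c1.
  by rewrite divr_ge0 ?(ltW eta0)// mulr_ge0// addr_ge0// sqr_ge0.
have c20 : 0 <= c2.
  by rewrite divr_ge0 ?sqr_ge0// mulr_ge0// sqr_ge0.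
pose m := (Num.truncn (4 + c1 + c2)).+1.
have hm : 4 + c1 + c2 <= m%:R by rewrite ltW// truncnS_gt.
have m4 : 4 <= m%:R :> R by lra.
have mc1 : c1 <= m%:R by lra.
have mc2 : c2 <= m%:R by lra.
have m0 : 0 < m%:R :> R by lra.
clear hm c10 c20.
pose a : R := m%:R^-1; pose J := (m ^ 3)%N.
have a0 : 0 < a by rewrite invr_gt0.
have am : a * m%:R = 1 by rewrite mulVf// gt_eqF.
have a4 : a <= 4^-1 by rewrite lef_pV2 ?posrE.
have JE : J%:R = m%:R ^+ 3 :> R by rewrite natrX.
have Ja : J%:R * a ^+ 3 = 1 by rewrite JE -exprMn mulrC am expr1n.
have Ja2 : J%:R * a ^+ 2 = m%:R.
  by rewrite JE exprS -mulrA -exprMn [m%:R * a]mulrC am expr1n mulr1.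
have J0 : 0 < J%:R :> R by rewrite JE exprn_gt0.
have J1 : 1 <= J%:R :> R by rewrite JE exprn_ege1//; lra.
(* [q] is the total error allowed over all [J] steps, shared equally as [tau]. *)
pose q := Num.min 1 (theta / 4); pose tau := q / J%:R.
have q0 : 0 < q by rewrite lt_min ltr01/= divr_gt0.
have q1 : q <= 1 by rewrite ge_min lexx.
have q4 : q <= theta / 4 by rewrite ge_min lexx orbT.
have tau0 : 0 < tau by rewrite divr_gt0.
have Jtau : J%:R * tau = q by rewrite /tau mulrC divfK// gt_eqF.
have tauq : tau <= q by rewrite ler_pdivrMr// ler_peMr// ltW.
have small : 2 * (a * (expR (B + 7) * H)) ^+ 2 + 2 * tau ^+ 2 <= (theta / 2) ^+ 2.
  have h1 : tau ^+ 2 <= (theta / 4) ^+ 2.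
    by rewrite ler_pXn2r ?nnegrE ?(ltW tau0) ?divr_ge0 ?(ltW theta0)//; exact: le_trans tauq q4.
  have h2 : 16 * (K * H) ^+ 2 * a <= theta ^+ 2.
    move: mc2; rewrite /c2 ler_pdivrMr ?exprn_gt0// => /(ler_wpM2r (ltW a0)).
    by rewrite (mulrAC m%:R) [m%:R * a]mulrC am mul1r.
  have h3 : (a * (K * H)) ^+ 2 <= (K * H) ^+ 2 * a.
    rewrite exprMn mulrC ler_wpM2l ?sqr_ge0// expr2 ler_piMl ?(ltW a0)//; lra.
  have e2 : (theta / 2) ^+ 2 = theta ^+ 2 / 4 by field.
  have e4 : (theta / 4) ^+ 2 = theta ^+ 2 / 16 by field.
  by rewrite e2 -/K; move: h1; rewrite e4; lra.
have a04 : 0 <= a <= 4^-1 by rewrite (ltW a0).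
have Ja' : J%:R * a ^+ 3 <= 1 by rewrite Ja.
have Jt' : J%:R * tau <= theta / 2 by rewrite Jtau; lra.
have [X [rho [g [M' [MM' st]]]]] :=
  walk_iterate M Lseg A0 (ltW B0) a04 tau0 theta0 bf fH small Ja' Jt'.
exists g, M'; case: st => bX brho Xb rhob Xm Xs gs gerr gpart.
have einv0 : 0 <= eta^-1 by rewrite invr_ge0 ltW.
split => //; last first.
  move=> N; have [rho' [b1 b2 b3]] := gpart N.
  have bfg := cbmB bf (cbm_trig_sum g N).
  have bd := bm_cabs (cbmB bfg b1).
  apply: (@le_trans _ _ (mean (fun t => eta^-1 * cabs (f t - trig_sum g N t - rho' t)))).
    apply: prob_le_mean.
    - exact: measurable_cabs_lt.
    - exact: (bmM (bm_cst _) bd).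
    - by move=> t; rewrite mulr_ge0// cabs_ge0.
    - move=> t /= ht; rewrite mulrC ler_pdivlMr// mul1r.
      have := cabsD (f t - trig_sum g N t - rho' t) (rho' t); rewrite subrK.
      by have := b2 t; lra.
  rewrite (meanZ _ bd) mulrC ler_pdivrMr//; exact: le_trans b3 _.
have bfg := cbmB bf (cbm_trig_sum g M').
have bd := bm_cabs (cbmB bfg brho).
have bA := bm_active A B bX.
have binv0 : 0 <= B^-1 by rewrite invr_ge0 ltW.
(* Three reasons for failure, each with its Markov majorant: a large approximation error, a point
   still active, an exit at the top. *)
pose F1 t := eta^-1 * cabs (f t - trig_sum g M' t - rho t).
pose F2 t := active A B (X t).
pose F3 t := B^-1 * (X t + (A + 1)).
have b1 : bm F1 := bmM (bm_cst _) bd.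
have b2 : bm F2 := bA.
have bXA : bm (fun t => X t + (A + 1)) := bmD bX (bm_cst _).
have b3 : bm F3 := bmM (bm_cst _) bXA.
have F10 t : 0 <= F1 t by rewrite mulr_ge0// cabs_ge0.
have F20 t : 0 <= F2 t by have /andP[] := active01 A B (X t).
have F30 t : 0 <= F3 t.
  by rewrite mulr_ge0//; have /andP[h _] := Xb t; lra.
apply: (@le_trans _ _ (mean (fun t => F1 t + (F2 t + F3 t)))).
  apply: prob_le_mean.
  - exact: measurable_cabs_lt.
  - exact: (bmD b1 (bmD b2 b3)).
  - by move=> t; rewrite !addr_ge0.
  - move=> t /= ht; have [h|h] := leP 1 (F1 t).
      by rewrite (le_trans h)// lerDl addr_ge0.
    have hF1 : cabs (f t - trig_sum g M' t - rho t) < eta.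
      by move: h; rewrite /F1 mulrC ltr_pdivrMr// mul1r.
    have hr : expR (6 - A) * cabs (f t) < cabs (rho t).
      have := cabsD (f t - trig_sum g M' t - rho t) (rho t); rewrite subrK.
      lra.
    have XA : - A < X t.
      rewrite ltNge; apply/negP => XA; have := rhob t; rewrite Ja mulr1.
      move=> /(lt_le_trans hr); rewrite mulrC ltNge => /negP; apply.
      by rewrite ler_wpM2l ?cabs_ge0// ler_expR; lra.
    have [XB|XB] := ltP (X t) B.
      have -> : F2 t = 1 by rewrite /F2 /active XA XB.
      by rewrite addrCA lerDl addr_ge0.
    have h3 : 1 <= F3 t by rewrite /F3 mulrC ler_pdivlMr// mul1r; lra.
    by rewrite (le_trans h3)// addrA lerDr addr_ge0.
rewrite (meanD b1 (bmD b2 b3)) (meanD b2 b3).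
have m1 : mean F1 <= eta / 4.
  rewrite /F1 (meanZ _ bd) mulrC ler_pdivrMr//; apply: le_trans gerr _.
  by rewrite Jtau; apply: le_trans q4 _; rewrite /theta; lra.
have m3 : mean F3 <= (A + 2) / B.
  rewrite /F3 (meanZ _ bXA) mulrC ler_wpM2r// (meanD bX (bm_cst _)) mean_cst.
  by move: Xm; rewrite Jtau; lra.
have m2 : mean F2 <= eta / 2.
  have hX : mean (fun t => X t ^+ 2) <= (A + B + 1) ^+ 2.
    rewrite -[leRHS](@mean_cst R); apply: (le_mean (bmX 2 bX) (bm_cst _)) => t.
    rewrite -real_normK ?num_real// ler_pXn2r ?nnegrE//; first
      by rewrite ler_norml; have /andP[h1 h2] := Xb t; lra.
    lra.
  move: Xs; rewrite Jtau mulrA Ja2.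
  rewrite (_ : mean (active A B \o X) = mean F2)// => Xs.
  have F2m : 0 <= mean F2 by exact: mean_ge0.
  move: mc1; rewrite /c1 ler_pdivrMr// => mc1.
  have : m%:R * mean F2 <= m%:R * (eta / 2) by lra.
  by rewrite ler_pM2l.
lra.
Qed.

End Approximation.
(** * Stages and gluing *)

Section Stage.
Variable R : realType.
Notation T := (lebesgueTypeR R).
Notation bm := (@bounded_measurable R).
Notation cbm := (@complex_bm R).
Notation cmeas f := (measurable_fun_complex (f : T -> R[i])).

Lemma measurable_cabs (r : R -> R[i]) : cmeas r ->
  measurable_fun [set: T] (fun t : T => cabs (r t)).
Proof.
move=> [mr mi].
apply: (@measurableT_comp _ _ _ _ _ _ (@Num.sqrt R) _
  (fun t : T => complex.Re (r t) ^+ 2 + complex.Im (r t) ^+ 2)).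
  by apply: continuous_measurable_fun; exact: sqrt_continuous.
by apply: measurable_funD; exact: measurable_funX.
Qed.

Lemma measurable_cabs_gt (r : R -> R[i]) (c : R) : cmeas r ->
  measurable ([set t | c < cabs (r t)] : set T).
Proof.
move=> mr.
exact: (@measurable_ltr R (cst c) _ (measurable_cst _) (measurable_cabs mr)).
Qed.

Lemma cmeasB (r p : R -> R[i]) : cmeas r -> cbm p -> cmeas (fun t => r t - p t).
Proof.
move=> [mr mi] [pr pi]; split.
  rewrite (_ : (fun _ => _) = fun t => complex.Re (r t) - complex.Re (p t)).
    exact: (measurable_funB mr (bm_measurable pr)).
  by apply/funext => t; rewrite raddfB.
rewrite (_ : (fun _ => _) = fun t => complex.Im (r t) - complex.Im (p t)).
  exact: (measurable_funB mi (bm_measurable pi)).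
by apply/funext => t; rewrite raddfB.
Qed.

Lemma cbm_restrict (r : R -> R[i]) (S : set R) (H : R) : cmeas r ->
  measurable (S : set T) -> (forall t, S t -> cabs (r t) <= H) ->
  cbm (fun t => (\1_S t)%:C * r t).
Proof.
move=> [mr mi] mS SH; have mI := @measurable_indic _ T R setT S mS.
split.
  rewrite (_ : (fun _ => _) = fun t => \1_S t * complex.Re (r t)); last first.
    by apply/funext => t; rewrite complex_ReM /= mul0r subr0.
  split; first exact: (measurable_funM mI mr).
  exists `|H| => t; rewrite indicE; have [St|St] := pselect (S t).
    rewrite (mem_set St) mul1r (le_trans (cabs_Re _))// (le_trans (SH t St))//.
    exact: ler_norm.
  by rewrite (memNset St) mul0r normr0.
rewrite (_ : (fun _ => _) = fun t => \1_S t * complex.Im (r t)); last first.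
  by apply/funext => t; rewrite complex_ImM /= mul0r addr0.
split; first exact: (measurable_funM mI mi).
exists `|H| => t; rewrite indicE; have [St|St] := pselect (S t).
  rewrite (mem_set St) mul1r (le_trans (cabs_Im _))// (le_trans (SH t St))//.
  exact: ler_norm.
by rewrite (memNset St) mul0r normr0.
Qed.

(** The function is finite everywhere, so the indicators of its level sets tend pointwise to 0 and
    dominated convergence applies. *)
Lemma prob_tail (r : R -> R[i]) (d : R) : cmeas r -> 0 < d ->
  exists2 H : R, 0 <= H & prob [set t | H < cabs (r t)] <= d.
Proof.
move=> mr d0.
have mE n := measurable_cabs_gt n%:R mr.
have h : (fun n : nat => mean (\1_[set t | n%:R < cabs (r t)] : R -> R)) @ \oo -->
    mean (fun=> 0 : R).
  apply: (@mean_cvg _ _ _ 1).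
  - by move=> n; exact: (bm_indic (mE n)).
  - exact: bm_cst.
  - move=> n t; have /andP[i0 i1] := indic_itv01 [set t | n%:R < cabs (r t)] t.
    by rewrite ger0_norm.
  - move=> t; apply: cvg_near_cst.
    exists (Num.truncn (cabs (r t))).+1 => // n /= tn.
    rewrite indicE memNset//= => h; have := lt_trans h (truncnS_gt (cabs (r t))).
    by rewrite ltr_nat ltnNge tn.
rewrite mean_cst in h; move/cvgrPdist_lt : h => /(_ _ d0)[N _ /(_ N (leqnn N))].
rewrite sub0r normrN => /(le_lt_trans (ler_norm _))/ltW hN.
by exists N%:R.
Qed.

Lemma prob_le_sum (E E1 E2 E3 : set R) : measurable (E : set T) ->
  measurable (E1 : set T) -> measurable (E2 : set T) -> measurable (E3 : set T) ->
  (forall t, E t -> [\/ E1 t, E2 t | E3 t]) ->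
  prob E <= prob E1 + (prob E2 + prob E3).
Proof.
move=> mE m1 m2 m3 sub.
have b1 := bm_indic m1; have b2 := bm_indic m2; have b3 := bm_indic m3.
rewrite /prob -(meanD b2 b3) -(meanD b1 (bmD b2 b3)).
have i0 (A : set R) t : 0 <= \1_A t :> R by have /andP[] := indic_itv01 A t.
apply: (prob_le_mean mE (bmD b1 (bmD b2 b3))) => t; first by rewrite !addr_ge0.
move=> /sub [h|h|h].
- by rewrite [\1_E1 t]indicE mem_set// lerDl addr_ge0.
- by rewrite [\1_E2 t]indicE mem_set// addrCA lerDl addr_ge0.
- by rewrite [\1_E3 t]indicE mem_set// addrA lerDr addr_ge0.
Qed.

Lemma trig_sumD (g h : nat -> R[i]) N t :
  trig_sum (fun k => g k + h k) N t = trig_sum g N t + trig_sum h N t.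
Proof. by rewrite /trig_sum -big_split; apply: eq_bigr => k _; rewrite mulrDl. Qed.

Lemma expRN_mul_le (x H d : R) : 0 <= H -> 0 < d -> expR (- (H / d)) * H <= d.
Proof.
move=> H0 d0; have := expR_ge1Dx (H / d).
have := expR_gt0 (H / d); rewrite expRN; set E := expR _ => E0 h.
rewrite mulrC ler_pdivrMr//.
have hd : H / d * d = H by rewrite divfK// gt_eqF.
have : H / d * d <= E * d by rewrite ler_wpM2r ?(ltW d0)//; lra.
by rewrite hd mulrC.
Qed.

(** Split [r] at heights [kappa] and [H]. The low part [f1] gets [A = 8], hence a reduction by
    [expR (-2)]; the middle part [f2] gets an [A2] that makes it negligible. The partial sums for
    [f2] may be wild only where [r] exceeds [kappa], a set already counted by [delta]. *)
Lemma approximation_stage (L : set int) (r : R -> R[i]) (kappa B delta : R) (M : nat) :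
  (forall M W : nat, exists p : nat, (M <= p)%N /\
    forall k, (k < W)%N -> L (p + k)%:Z) ->
  cmeas r -> 0 < kappa -> 0 < B -> prob [set t | kappa < cabs (r t)] <= delta ->
  exists (g : nat -> R[i]) (M' : nat),
  [/\ (M <= M')%N,
      forall k, g k != 0 -> (M <= k < M')%N /\ L k%:Z,
      prob [set t | expR (-1) * kappa < cabs (r t - trig_sum g M' t)] <= 14 / B &
      forall N, prob [set t | 2 * expR (B + 7) * kappa < cabs (r t - trig_sum g N t)]
        <= delta + 2 / B].
Proof.
move=> Lseg mr k0 B0 hdelta.
have Binv : 0 < B^-1 by rewrite invr_gt0.
have [H H0 hH] := prob_tail mr Binv.
(* The room between [expR (-2) * kappa] and the target, in three parts: one for each of the two
   errors [eta], one for what remains of [f2]. *)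
pose d := (expR (-1) - expR (-2)) * kappa.
have d0 : 0 < d by rewrite mulr_gt0// subr_gt0 ltr_expR; lra.
have d30 : 0 < d / 3 by rewrite divr_gt0.
pose eta := Num.min B^-1 (Num.min (d / 3) (kappa / 2)).
have eta0 : 0 < eta by rewrite !lt_min Binv d30 divr_gt0.
have etaB : eta <= B^-1 by rewrite ge_min lexx.
have etad : eta <= d / 3 by rewrite !ge_min lexx !orbT.
have etak : eta <= kappa / 2 by rewrite !ge_min lexx !orbT.
pose S1 := [set t | cabs (r t) <= kappa].
pose S2 := [set t | kappa < cabs (r t)] `&` [set t | cabs (r t) <= H].
have mgt c := measurable_cabs_gt c mr.
have mle c : measurable ([set t | cabs (r t) <= c] : set T).
  exact: (@measurable_ler R _ (cst c) (measurable_cabs mr) (measurable_cst _)).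
have mS1 : measurable (S1 : set T) := mle kappa.
have mS2 : measurable (S2 : set T) by apply: measurableI.
pose f1 t := (\1_S1 t)%:C * r t; pose f2 t := (\1_S2 t)%:C * r t.
have bf1 : cbm f1 by apply: (@cbm_restrict _ _ kappa).
have bf2 : cbm f2 by apply: (@cbm_restrict _ _ H) => // t [].
have f1k t : cabs (f1 t) <= kappa.
  rewrite /f1 cabsM cabsR indicE; have [St|St] := pselect (S1 t).
    by rewrite (mem_set St) normr1 mul1r.
  by rewrite (memNset St) normr0 mul0r ltW.
have f2H t : cabs (f2 t) <= H.
  rewrite /f2 cabsM cabsR indicE; have [St|St] := pselect (S2 t).
    by rewrite (mem_set St) normr1 mul1r; case: St.
  by rewrite (memNset St) normr0 mul0r.
have rf1 t : cabs (r t) <= kappa -> f1 t = r t /\ f2 t = 0.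
  move=> h; rewrite /f1 /f2 !indicE (mem_set (h : S1 t)) mul1r memNset ?mul0r//.
  by move=> [/=]; rewrite ltNge h.
have rf2 t : cabs (r t) <= H -> r t = f1 t + f2 t.
  move=> h; have [/rf1[-> ->]|hk] := leP (cabs (r t)) kappa; first by rewrite addr0.
  rewrite /f1 /f2 !indicE (mem_set (conj hk h : S2 t)) memNset ?mul0r ?mul1r ?add0r//.
  by rewrite /S1 /= leNgt hk.
pose A2 := 6 + H / (d / 3).
have A20 : 0 <= A2 by rewrite addr_ge0// divr_ge0// ltW.
(* Chosen so that the exit probability [(A2 + 2) / B2] is [1 / B], however large [A2] is. *)
pose B2 := B * (A2 + 2).
have B20 : 0 < B2 by rewrite mulr_gt0//; lra.
have [g1 [M1 [MM1 s1 e1 p1]]] :=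
  walk_approximation M Lseg (ltac:(lra) : 0 <= 8 :> R) B0 eta0 bf1 f1k.
(* The second block starts where the first ends, so at [M2] the sum for [g1] is already complete. *)
have [g2 [M2 [MM2 s2 e2 p2]]] :=
  walk_approximation M1 Lseg A20 B20 eta0 bf2 f2H.
have msub g N (c : R) : measurable ([set t | c < cabs (r t - trig_sum g N t)] : set T).
  exact: (measurable_cabs_gt c (cmeasB mr (cbm_trig_sum g N))).
exists (fun k => g1 k + g2 k), M2; split.
- exact: leq_trans MM1 MM2.
- move=> k gk; have [g1k|g1k] := eqVneq (g1 k) 0.
    move: gk; rewrite g1k add0r => /s2[/andP[h1 h2] Lk]; split; last exact: Lk.
    by rewrite (leq_trans MM1 h1).
  have [/andP[h1 h2] Lk] := s1 _ g1k; split; last exact: Lk.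
  by rewrite h1 (leq_trans h2 MM2).
- have sum1 t : trig_sum g1 M2 t = trig_sum g1 M1 t.
    apply: trig_sum_stable => // k Mk; apply/eqP/negPn/negP => /s1[/andP[_]].
    by rewrite ltnNge Mk.
  have B2E : (A2 + 2) / B2 = B^-1.
    rewrite /B2 invfM mulrCA mulfV ?mulr1// gt_eqF//.
    by move: A20; clear; lra.
  have sumle : B^-1 + ((8 + 2) / B + eta + ((A2 + 2) / B2 + eta)) <= 14 / B.
    by rewrite B2E; move: etaB; clear; lra.
  apply: le_trans sumle; apply: le_trans _ (lerD hH (lerD e1 e2)).
  apply: prob_le_sum.
  + exact: msub.
  + exact: mgt.
  + exact: (measurable_cabs_lt _ _ bf1 (cbmB bf1 (cbm_trig_sum g1 M1))).
  + exact: (measurable_cabs_lt _ _ bf2 (cbmB bf2 (cbm_trig_sum g2 M2))).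
  move=> t /= ht; have [rH|rH] := ltP H (cabs (r t)); first exact: Or31.
  have [h1|h1] := ltP (expR (6 - 8) * cabs (f1 t) + eta) (cabs (f1 t - trig_sum g1 M1 t)).
    exact: Or32.
  have [h2|h2] := ltP (expR (6 - A2) * cabs (f2 t) + eta) (cabs (f2 t - trig_sum g2 M2 t)).
    exact: Or33.
  exfalso; move: ht; rewrite (rf2 t rH) trig_sumD sum1.
  have -> : f1 t + f2 t - (trig_sum g1 M1 t + trig_sum g2 M2 t) =
    (f1 t - trig_sum g1 M1 t) + (f2 t - trig_sum g2 M2 t) by ring.
  have c1 : expR (6 - 8) * cabs (f1 t) <= expR (-2) * kappa.
    have -> : 6 - 8 = -2 :> R by clear; lra.
    by rewrite ler_wpM2l ?expR_ge0.
  have c2 : expR (6 - A2) * cabs (f2 t) <= d / 3.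
    apply: le_trans (expRN_mul_le 0 H0 d30).
    have -> : 6 - A2 = - (H / (d / 3)) by rewrite /A2; clear; lra.
    by rewrite ler_wpM2l ?expR_ge0.
  move=> /lt_le_trans/(_ (cabsD _ _)).
  have dE : d = expR (-1) * kappa - expR (-2) * kappa by rewrite /d mulrBl.
  by move: h1 h2 c1 c2 etad dE; clear; lra.
- move=> N.
  have sumle : delta + (eta + eta) <= delta + 2 / B by move: etaB; clear; lra.
  apply: le_trans sumle; apply: le_trans _ (lerD hdelta (lerD (p1 N) (p2 N))).
  apply: prob_le_sum.
  + exact: msub.
  + exact: mgt.
  + exact: (measurable_cabs_lt _ _ bf1 (cbmB bf1 (cbm_trig_sum g1 N))).
  + exact: (measurable_cabs_lt _ _ bf2 (cbmB bf2 (cbm_trig_sum g2 N))).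
  move=> t /= ht; have [rk|rk] := ltP kappa (cabs (r t)); first exact: Or31.
  have [h1|h1] := ltP (expR (B + 7) * cabs (f1 t) + eta) (cabs (f1 t - trig_sum g1 N t)).
    exact: Or32.
  have [h2|h2] := ltP (expR (B2 + 7) * cabs (f2 t) + eta) (cabs (f2 t - trig_sum g2 N t)).
    exact: Or33.
  (* Here [f2 t = 0], so the huge factor [expR (B2 + 7)] multiplies 0. *)
  exfalso; move: ht; have [f1r f20] := rf1 t rk.
  rewrite trig_sumD; move: h2; rewrite f20 cabs0 mulr0 => h2.
  have -> : r t - (trig_sum g1 N t + trig_sum g2 N t) =
    (f1 t - trig_sum g1 N t) + (0 - trig_sum g2 N t) by rewrite f1r; ring.
  move=> /lt_le_trans/(_ (cabsD _ _)).
  have c1 : expR (B + 7) * cabs (f1 t) <= expR (B + 7) * kappa.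
    by rewrite ler_wpM2l ?expR_ge0.
  have c2 : kappa <= expR (B + 7) * kappa.
    by rewrite ler_peMl ?(ltW k0)// -[leLHS]expR0 ler_expR; move: B0; clear; lra.
  by move: h1 h2 c1 c2 etak; clear; lra.
Qed.

End Stage.

(** * Gluing the stages into one series *)

Section Representation.
Variable R : realType.
Notation T := (lebesgueTypeR R).
Notation bm := (@bounded_measurable R).
Notation cbm := (@complex_bm R).
Notation cmeas f := (measurable_fun_complex (f : T -> R[i])).

(** Since [L] is positive, only [0 <= k <= N] matters, which is [N.+1] terms; the added indices
    outside [L], among them 0, carry the coefficient 0. *)
Lemma trig_partial_sumE (L : set int) (d : nat -> R[i]) N t :
  (forall k : int, L k -> 0 < k) -> (forall k : nat, d k != 0 -> L k%:Z) ->
  trig_partial_sum L (fun k => d `|k|%N) N t = trig_sum d N.+1 t.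
Proof.
move=> Lpos dL; rewrite /trig_partial_sum /trig_sum.
pose F (k : int) := d `|k|%N * expik k t.
rewrite [RHS](fsbig_ord _ _ (fun k : nat => F k%:Z)).
rewrite (@fsbig_widen _ _ _ _ _ (Posz @` `I_N.+1)).
- by apply: reindex_fsbig; apply: inj_bij => x y _ _ [].
- move=> k [/= Lk kN]; have := Lpos _ Lk; case: k Lk kN => // k Lk kN _.
  by exists k.
- move=> _ [[k kN <-] nL] /=; rewrite /F /=.
  have [->|/dL Lk] := eqVneq (d k) 0; first by rewrite mul0r.
  by case: nL.
Qed.

(** The pair holds the coefficients and the end of their support. The condition [n <= s.2] sends the
    ends to infinity. Stage [n] runs with [B = n.+1 / 2], so [14 / B = 28 / n.+1], which is at most
    [56 / n.+2]. *)
Definition good_prefix (L : set int) (f : R -> R[i]) (n : nat)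
    (s : (nat -> R[i]) * nat) :=
  [/\ (n <= s.2)%N, forall k, s.1 k != 0 -> (k < s.2)%N /\ L k%:Z &
    prob [set t | expR (- n.+1%:R) < cabs (f t - trig_sum s.1 s.2 t)] <=
      56 / n.+1%:R].

(** The threshold is [2 * expR (B + 7) * kappa] for [B = n.+1 / 2] and [kappa = expR (- n.+1)]; the
    bound is [56 / n.+1] for the set where the residual was large plus [2 / B = 4 / n.+1]. *)
Definition good_extension (f : R -> R[i]) (n : nat)
    (s s' : (nat -> R[i]) * nat) :=
  [/\ (s.2 <= s'.2)%N, forall k, (k < s.2)%N -> s'.1 k = s.1 k &
    forall N, (s.2 <= N)%N ->
    prob [set t | 2 * expR (7 - n.+1%:R / 2) < cabs (f t - trig_sum s'.1 N t)] <=
      60 / n.+1%:R].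

Lemma good_prefix0 (L : set int) (f : R -> R[i]) : cmeas f ->
  good_prefix L f 0 (fun=> 0, 0%N).
Proof.
move=> mf; split=> //=; first by move=> k; rewrite eqxx.
have mE : measurable ([set t | expR (-1) < cabs (f t - trig_sum (fun=> 0) 0 t)] : set T).
  exact: (measurable_cabs_gt _ (cmeasB mf (cbm_trig_sum _ _))).
rewrite divr1; apply: (@le_trans _ _ 1); last by clear; lra.
rewrite -[leRHS](@mean_cst R); apply: prob_le_mean => //; exact: bm_cst.
Qed.

Lemma good_prefixS (L : set int) (f : R -> R[i]) n s :
  (forall M W : nat, exists p : nat, (M <= p)%N /\
    forall k, (k < W)%N -> L (p + k)%:Z) ->
  cmeas f -> good_prefix L f n s ->
  exists s', good_prefix L f n.+1 s' /\ good_extension f n s s'.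
Proof.
case: s => g M Lseg mf [/= nM gs hg].
have n0 : 0 < n.+1%:R :> R by rewrite ltr0n.
have n1 : 1 <= n.+1%:R :> R by rewrite ler1n.
have mr := cmeasB mf (cbm_trig_sum g M).
have B0 : 0 < n.+1%:R / 2 :> R by rewrite divr_gt0.
have [h [M' [MM' hs h1 h2]]] :=
  approximation_stage M Lseg mr (expR_gt0 _) B0 hg.
have g0 k : (M <= k)%N -> g k = 0.
  by move=> Mk; apply/eqP/negPn/negP => /gs[]; rewrite ltnNge Mk.
have h0 k : (k < M)%N -> h k = 0.
  by move=> kM; apply/eqP/negPn/negP => /hs[/andP[]]; rewrite leqNgt kM.
have h0' k : (M' <= k)%N -> h k = 0.
  by move=> kM; apply/eqP/negPn/negP => /hs[/andP[_]]; rewrite ltnNge kM.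
have sumE N t : (M <= N)%N ->
    f t - trig_sum (fun k => g k + h k) N t = f t - trig_sum g M t - trig_sum h N t.
  by move=> MN; rewrite trig_sumD (trig_sum_stable t g0 MN); ring.
have B2 : 2 / (n.+1%:R / 2) = 4 / n.+1%:R :> R by field; rewrite gt_eqF.
(* The successor makes the end grow strictly, as [n.+1 <= s'.2] demands. *)
exists (fun k => g k + h k, M'.+1); split; split => /=.
- by rewrite ltnS (leq_trans nM).
- move=> k ghk; have [gk|gk] := eqVneq (g k) 0.
    move: ghk; rewrite gk add0r => /hs[/andP[_ kM] Lk].
    by split; [exact: ltnW|].
  have [kM Lk] := gs _ gk; split; last exact: Lk.
  by rewrite ltnS ltnW// (leq_trans kM MM').
- have sumM t : f t - trig_sum (fun k => g k + h k) M'.+1 t =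
      f t - trig_sum g M t - trig_sum h M' t.
    rewrite sumE; last exact: leq_trans MM' (leqnSn _).
    by rewrite (trig_sum_stable t h0' (leqnSn M')).
  have eE : expR (-1) * expR (- n.+1%:R) = expR (- n.+2%:R) :> R.
    by rewrite -expRD -[n.+2%:R]natr1 opprD addrC.
  move: h1; rewrite eE; under eq_set do rewrite -sumM.
  move/le_trans; apply.
  rewrite ler_pdivrMr// mulrAC ler_pdivlMr ?ltr0n//.
  rewrite -[n.+2%:R]natr1; move: n1; clear; lra.
- exact: leq_trans MM' (leqnSn _).
- by move=> k kM; rewrite (h0 k kM) addr0.
- move=> N MN; have := h2 N.
  have -> : 2 * expR (n.+1%:R / 2 + 7) * expR (- n.+1%:R) =
      2 * expR (7 - n.+1%:R / 2) :> R.
    by rewrite -mulrA -expRD; congr (2 * expR _); clear; lra.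
  under eq_set do rewrite -(sumE _ _ MN).
  have -> : 60 / n.+1%:R = 56 / n.+1%:R + 2 / (n.+1%:R / 2) :> R.
    by rewrite B2 -mulrDl; congr (_ / _); clear; lra.
  by [].
Qed.

(** Successive stages extend one another, so they define a single sequence [d]. A partial sum of [d]
    that ends within stage [n] is off by at most [2 * expR (7 - n.+1 / 2)] outside a set of
    probability [60 / n.+1], and both quantities tend to 0. *)
Lemma represents_in_measure (L : set int) (f : R -> R[i]) :
  (forall M W : nat, exists p : nat, (M <= p)%N /\
    forall k, (k < W)%N -> L (p + k)%:Z) ->
  cmeas f ->
  exists d : nat -> R[i], (forall k, d k != 0 -> L k%:Z) /\
    forall eps del : R, 0 < eps -> 0 < del -> exists N0 : nat, forall N, (N0 <= N)%N ->
      prob [set t | eps <= cabs (trig_sum d N t - f t)] <= del.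
Proof.
move=> Lseg mf.
(* The hypothesis sits under the existential so that [choice] yields a total function; on bad pairs
   its value is arbitrary. *)
have ex p : exists s', good_prefix L f p.1 p.2 ->
    good_prefix L f p.1.+1 s' /\ good_extension f p.1 p.2 s'.
  have [hp|hp] := pselect (good_prefix L f p.1 p.2).
    by have [s' hs'] := good_prefixS Lseg mf hp; exists s'.
  by exists p.2.
have [step hstep] := choice ex.
pose s := fix s n := if n is m.+1 then step (m, s m) else (fun=> 0 : R[i], 0%N).
have hs n : good_prefix L f n (s n).
  by elim: n => [|n IH]; [exact: good_prefix0|have [] := hstep (n, s n) IH].
have es n : good_extension f n (s n) (s n.+1) by have [] := hstep (n, s n) (hs n).
have Mmono n m : ((s n).2 <= (s (n + m)).2)%N.
  elim: m => [|m IH]; first by rewrite addn0.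
  by rewrite addnS; apply: leq_trans IH _; have [] := es (n + m)%N.
have compat n m k : (k < (s n).2)%N -> (s (n + m)%N).1 k = (s n).1 k.
  move=> kM; elim: m => [|m IH]; first by rewrite addn0.
  rewrite addnS -IH; have [_ h _] := es (n + m)%N; apply: h.
  exact: leq_trans kM (Mmono n m).
have compat' n m k : (k < (s n).2)%N -> (k < (s m).2)%N -> (s n).1 k = (s m).1 k.
  move=> kn km; have [nm|mn] := leqP n m.
    by rewrite -(subnKC nm) compat.
  by rewrite -(subnKC (ltnW mn)) compat.
(* Stage [k.+1] ends beyond [k], so its [k]-th coefficient is final. *)
pose d k := (s k.+1).1 k; exists d.
have Mk k : (k < (s k.+1).2)%N by have [] := hs k.+1.
split; first by move=> k; have [_ h _] := hs k.+1; move=> /h[].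
have sumd n N t : (N <= (s n).2)%N -> trig_sum d N t = trig_sum (s n).1 N t.
  move=> Nn; apply: eq_bigr => k _; congr (_ * _); apply: compat' => //.
  exact: leq_trans (ltn_ord k) Nn.
move=> eps del eps0 del0.
have [n0 hn0] : exists n0 : nat, forall n, (n0 <= n)%N ->
    2 * expR (7 - n.+1%:R / 2) < eps /\ 60 / n.+1%:R <= del.
  pose c := 2 * expR 7 / eps * 2; pose c' := 60 / del.
  have c0 : 0 <= c by rewrite mulr_ge0// divr_ge0 ?mulr_ge0 ?expR_ge0// ltW.
  have c0' : 0 <= c' by rewrite divr_ge0// ltW.
  exists (Num.truncn (c + c')).+1 => n hn.
  have h : c + c' <= n.+1%:R.
    apply: le_trans (ltW (truncnS_gt _)) _; rewrite ler_nat; exact: leq_trans hn _.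
  have np : 0 < n.+1%:R :> R by rewrite ltr0n.
  split; last first.
    rewrite ler_pdivrMr// mulrC -ler_pdivrMr//; move: h c0; rewrite /c'; clear; lra.
  have hc : c <= n.+1%:R by move: h c0'; clear; lra.
  have e1 := expR_gt0 (n.+1%:R / 2 : R).
  rewrite expRD expRN mulrA ltr_pdivrMr//.
  move: hc; rewrite /c -ler_pdivlMr// ler_pdivrMr// => hc.
  apply: le_lt_trans hc _; rewrite mulrC ltr_pM2l//.
  have := expR_ge1Dx (n.+1%:R / 2 : R); clear; lra.
exists (s n0).2 => N n0N.
(* [n] is the last stage ending at or before [N]; it exists because stage [n] ends no earlier than
   [n]. *)
have [n /andP[nN Nn] nmax] : exists2 n, ((s n).2 <= N < (s n.+1).2)%N & (n0 <= n)%N.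
  have bnd n : ((s n).2 <= N)%N -> (n <= N)%N.
    by apply: leq_trans; have [] := hs n.
  have exN : exists n, ((s n).2 <= N)%N by exists n0.
  have [n nN nmax] := ex_maxnP exN bnd.
  exists n; last exact: nmax.
  by rewrite nN ltnNge; apply/negP => /nmax; rewrite ltnn.
have [h1 h2] := hn0 _ nmax; have [_ _ /(_ N nN) h3] := es n.
apply: le_trans (le_trans h3 h2).
have bE := cmeasB mf (cbm_trig_sum (s n.+1).1 N).
have E2 := measurable_cabs_gt (2 * expR (7 - n.+1%:R / 2)) bE.
have sumE t : cabs (trig_sum d N t - f t) = cabs (f t - trig_sum (s n.+1).1 N t).
  by rewrite (sumd n.+1 N t (ltnW Nn)) -cabsN opprB.
have E1 : measurable ([set t | eps <= cabs (trig_sum d N t - f t)] : set T).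
  under eq_set do rewrite sumE.
  exact: (@measurable_ler R (cst eps) _ (measurable_cst _) (measurable_cabs bE)).
apply: (prob_le_mean E1 (bm_indic E2)) => t.
  by have /andP[] := indic_itv01 [set t | 2 * expR (7 - n.+1%:R / 2) < cabs (f t - trig_sum (s n.+1).1 N t)] t.
rewrite /= sumE => ht; rewrite indicE mem_set//=.
exact: lt_le_trans h1 ht.
Qed.

End Representation.

Theorem theorem6 (R : realType) (L : set int)
    (Lpos : forall k : int, L k -> (0 < k)%R)
    (Lseg : has_long_segments L) :
  menshov_spectrum_in_measure R L.
Proof.
move=> f [_ mf].
have [d [dL hd]] := represents_in_measure (long_segments_nat Lpos Lseg) mf.
(* The coefficients are indexed by integers; on the positive set [L] the absolute value is the
   identity. *)
exists (fun k => d `|k|%N) => eps eps0.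
pose E N := [set t : R | eps <= cabs (trig_sum d N.+1 t - f t)].
have EE N : [set t | eps%:C <= `|trig_partial_sum L (fun k => d `|k|%N) N t - f t|] = E N.
  by apply/seteqP; split => t /=; rewrite trig_partial_sumE// cabsE lecR.
have mE N : measurable (E N : set (lebesgueTypeR R)).
  have mr := cmeasB mf (cbm_trig_sum d N.+1).
  have -> : E N = [set t | eps <= cabs (f t - trig_sum d N.+1 t)].
    by apply/seteqP; split => t /=; rewrite -cabsN opprB.
  exact: (@measurable_ler R (cst eps) _ (measurable_cst _) (measurable_cabs mr)).
have -> : (fun N => circle_measure R [set t | eps%:C <=
    `|trig_partial_sum L (fun k => d `|k|%N) N t - f t|]) = (fun N => (prob (E N))%:E).
  by apply/funext => N; rewrite EE probE.
apply: cvg_EFin; first exact: nearW.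
apply/cvgrPdist_le => del del0; have [N0 hN0] := hd _ _ eps0 del0.
exists N0 => // N /= NN; rewrite sub0r normrN ger0_norm.
  (* The partial sum up to [N] is [trig_sum] with [N.+1] terms, hence the shift by one. *)
  by apply: hN0; exact: leqW.
by apply: mean_ge0 => t; rewrite indicE; case: (_ \in _).
Qed.
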